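(* Let $P$ be a semi-Eulerian simplicial poset of rank $n+1$. Then \[ \Phi_P(c,d)=\sum_{i=0}^{n-1}h_i(P)\,\check\Phi^n_i(c,d). \]
   Context: All posets are finite graded posets with unique minimum $\hat0$ and maximum $\hat1$. $P$ (rank $n+1$) is semi-Eulerian if every interval $[s,t]\neq[\hat0,\hat1]$ with more than one element has as many elements of odd rank as of even rank; Eulerian if additionally $P$ itself has this property. Flag $f$-vector: for $S=\{\ell_1<\dots<\ell_k\}\subseteq[n]$, $f_S(P)$ counts chains $\hat0<x_1<\dots<x_k<\hat1$ with $\mathrm{rk}(x_i)=\ell_i$. $\chi(P)=\sum_{j=1}^n(-1)^{j-1}f_{\{j\}}(P)$, $\chi(\mathbb S^{n-1})=1-(-1)^n$. $u_S=u_1\cdots u_n$ with $u_i=b$ if $i\in S$, $a$ otherwise (non-commuting $a,b$). Set $f'_S(P)=f_S(P)$ for $S\ne\{n\}$ and $f'_{\{n\}}(P)=f_{\{n\}}(P)+\chi(\mathbb S^{n-1})-\chi(P)$, $\chi'_P(a,b)=\sum_S f'_S(P)u_S$. The $cd$-index $\Phi_P(c,d)$ is the (unique) polynomial in non-commuting $c,d$ with $\Phi_P(a+b,ab+ba)=\chi'_P(a-b,b)$ (for Eulerian $P$ this is the usual $cd$-index). $P$ is simplicial if every interval $[\hat0,x]$, $x\ne\hat1$, is a Boolean algebra; $f_{i-1}(P)$ is the number of $x$ with $[\hat0,x]$ Boolean of rank $i$, and the $h$-vector is defined by $\sum_{i=0}^n f_{i-1}(P)(x-1)^{n-i}=\sum_{i=0}^n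 h_i(P)x^{n-i}$. The polynomials $\check\Phi^n_i$: let $\Lambda^n$ be the boundary complex of an $n$-simplex with facets $\sigma_0,\dots,\sigma_n$; for $0\le i\le n-1$ let $\Gamma^n_i$ be the simplicial complex generated by $\sigma_0,\dots,\sigma_i$ (an $(n-1)$-ball), and let $\Lambda^n_i$ be its semisuspension, the regular CW complex obtained from $\Gamma^n_i$ by attaching one new $(n-1)$-cell $\tau$ with $\partial\tau=\partial\Gamma^n_i$ (so $\Lambda^n_{n-1}=\Lambda^n$). For a regular CW sphere $\Lambda$, $\Phi_\Lambda$ is the $cd$-index of its face poset with $\hat0$ (empty face) and $\hat1$ adjoined, an Eulerian poset of rank $n+1$. Set $\check\Phi^n_0=\Phi_{\Lambda^n_0}$, $\check\Phi^n_i=\Phi_{\Lambda^n_i}-\Phi_{\Lambda^n_{i-1}}$ for $1\le i\le n-1$, and $\check\Phi^n_n=0$. *)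

(* Defs.v *)
From HB Require Import structures.
From mathcomp Require Import all_boot all_order all_algebra.
From Stdlib Require Import ClassicalEpsilon.

Set Implicit Arguments.
Unset Strict Implicit.
Unset Printing Implicit Defensive.

Import GRing.Theory.
Local Open Scope ring_scope.

(* Non-commutative polynomials over int in letters of type bool,       *)
(* represented by their coefficient function on words.                 *)
(* For ab-words: false = a, true = b.  For cd-words: false = c, true = d. *)

Definition ncpoly := seq bool -> int.

Definition ncmon (u : seq bool) : ncpoly := fun w => (nat_of_bool (w == u))%:Z.
Definition ncone : ncpoly := ncmon [::].

Definition ncmul (p q : ncpoly) : ncpoly :=
  fun w => \sum_(k < (size w).+1) p (take k w) * q (drop k w).

Definition ncword (s : bool -> ncpoly) (m : seq bool) : ncpoly :=
  foldr (fun l acc => ncmul (s l) acc) ncone m.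

(* substitution p(s(false), s(true)).  This is the usual substitution
   provided every s l has zero constant term (then words m longer than w
   cannot contribute to the coefficient of w); both substitutions used
   below have this property. *)
Definition ncsubst (s : bool -> ncpoly) (p : ncpoly) : ncpoly :=
  fun w => \sum_(k < (size w).+1) \sum_(m : k.-tuple bool) p m * ncword s m w.

Definition sub_ab (l : bool) : ncpoly :=
  if l then ncmon [:: true] else fun w => ncmon [:: false] w - ncmon [:: true] w.

Definition sub_cd (l : bool) : ncpoly :=
  if l then fun w => ncmon [:: false; true] w + ncmon [:: true; false] w
  else fun w => ncmon [:: false] w + ncmon [:: true] w.

Section Poset.
Variables (T : finType) (le : rel T) (bot top : T).

Definition is_chain (C : {set T}) : bool :=
  [forall x in C, forall y in C, le x y || le y x].

Definition is_maxchain (C : {set T}) : bool :=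
  is_chain C && [forall D : {set T}, (C \proper D) ==> ~~ is_chain D].

Definition graded_poset (n : nat) : Prop :=
  [/\ reflexive le, antisymmetric le & transitive le] /\
  [/\ (forall x, le bot x), (forall x, le x top)
    & (forall C : {set T}, is_maxchain C -> #|C| = n.+2)].

Definition rk (x : T) : nat :=
  (\max_(C : {set T} | is_chain C && (C \subset [set y | le bot y && le y x])) #|C|).-1.

Definition interval (s t : T) : {set T} := [set z | le s z && le z t].

Definition lt (x y : T) : bool := (x != y) && le x y.

Definition semi_eulerian : Prop :=
  forall s t, lt s t -> ~ (s = bot /\ t = top) ->
    #|[set z in interval s t | odd (rk z)]| = #|[set z in interval s t | ~~ odd (rk z)]|.

Definition boolean_below (x : T) (r : nat) : bool :=
  [exists f : {ffun {set 'I_r} -> T},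
     injectiveb f
     && [forall y, (y \in interval bot x) == (y \in codom f)]
     && [forall A, forall B, le (f A) (f B) == (A \subset B)]].

Definition simplicial : Prop :=
  forall x, x != top -> exists r, boolean_below x r.

(* fvec i = f_{i-1}(P) *)
Definition fvec (i : nat) : nat := #|[set x | boolean_below x i]|.

Definition hvec (n i : nat) : int :=
  (\sum_(j < n.+1) ((fvec j)%:Z)%:P * ('X - 1) ^+ (n - j) : {poly int})`_(n - i).

(* flag f-vector; S : {set 'I_n} encodes the rank set {i.+1 | i in S} in [n] *)
Definition flag_f (n : nat) (S : {set 'I_n}) : nat :=
  #|[set C : {set T} | [&& is_chain C, #|C| == #|S|,
       [forall x in C, exists i in S, rk x == (val i).+1] &
       [forall i in S, exists x in C, rk x == (val i).+1]]]|.

Definition euler_char (n : nat) : int :=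
  \sum_(j < n) (-1) ^+ j * (flag_f [set j])%:Z.

Definition euler_char_sphere (n : nat) : int := 1 - (-1) ^+ n.

Definition flag_f' (n : nat) (S : {set 'I_n}) : int :=
  (flag_f S)%:Z +
  (if (0 < n)%N && (S == [set i : 'I_n | val i == n.-1])
   then euler_char_sphere n - euler_char n else 0).

Definition uS (n : nat) (S : {set 'I_n}) : seq bool := [seq i \in S | i <- enum 'I_n].

Definition chi' (n : nat) : ncpoly :=
  fun w => \sum_(S : {set 'I_n}) flag_f' S * ncmon (uS S) w.

(* the cd-index: the (unique) Phi with Phi(a+b, ab+ba) = chi'(a-b, b) *)
Definition cd_index (n : nat) : ncpoly :=
  epsilon (inhabits (fun _ => 0))
    (fun Phi : ncpoly => forall w, ncsubst sub_cd Phi w = ncsubst sub_ab (chi' n) w).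

End Poset.

(* Vertices of the n-simplex: 'I_n.+1; facet sigma_j = [n] \ {j}.      *)

Section Lambda.
Variables (n i : nat).

Definition inGamma (F : {set 'I_n.+1}) : bool :=
  [exists j : 'I_n.+1, ((val j <= i)%N) && (j \notin F)].

Definition nfacets (G : {set 'I_n.+1}) : nat :=
  #|[set j : 'I_n.+1 | ((val j <= i)%N) && (j \notin G)]|.

(* faces of the boundary complex of the ball Gamma^n_i: faces of ridges
   (faces with n-1 vertices) lying in exactly one facet of Gamma^n_i *)
Definition inBoundary (F : {set 'I_n.+1}) : bool :=
  [exists G : {set 'I_n.+1}, [&& F \subset G, #|G| == n.-1 & nfacets G == 1%N]].

(* elements of the face poset (with 0^ and 1^) of Lambda^n_i:
   inl F = face F of Gamma^n_i (inl set0 = empty face = 0^),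
   inr false = the new cell tau, inr true = 1^ *)
Definition lam_elt (x : {set 'I_n.+1} + bool) : bool :=
  match x with inl F => inGamma F | inr _ => true end.

Definition Lam := {x : {set 'I_n.+1} + bool | lam_elt x}.

Definition lam_le_raw (x y : {set 'I_n.+1} + bool) : bool :=
  match x, y with
  | inl F, inl G => F \subset G
  | inl F, inr false => inBoundary F
  | _, inr true => true
  | inr false, inr false => true
  | _, _ => false
  end.

Definition lam_le : rel Lam := fun x y => lam_le_raw (val x) (val y).

Lemma lam_bot_proof : lam_elt (inl set0).
Proof.
by apply/existsP; exists ord0; rewrite in_set0.
Qed.

Definition lam_bot : Lam := exist _ (inl set0) lam_bot_proof.
Definition lam_top : Lam := exist _ (inr true) (erefl true).

Definition Phi_Lam : ncpoly := cd_index lam_le lam_bot n.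

End Lambda.

Definition check_Phi (n i : nat) : ncpoly :=
  if (n <= i)%N then (fun _ => 0)
  else if i is i'.+1 then (fun w => Phi_Lam n i w - Phi_Lam n i' w)
  else Phi_Lam n 0.

(* Main.v *)
(* Below rank n every flag number of a simplicial poset is a
   fixed linear function of f_(-1), ..., f_(n-2), because lower intervals are
   Boolean; flags through rank n are then forced by the alternating sum over
   [x, 1] being 0, and f' is corrected so that this holds for x = 0 too.  The
   semisuspensions Lambda^n_i share both properties, and the h-vector of
   Gamma^n_i is (1, ..., 1, 0, ..., 0) with i + 1 ones, so chi'_P is the
   combination of the chi' of the Lambda^n_i with the asserted coefficients.
   Any such flag function satisfies the generalized Dehn-Sommerville relations,
   hence has a cd-index; the cd-index being unique, the identity passes to Phi. *)
Require Import Defs.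
From Stdlib Require Import ClassicalEpsilon.
From mathcomp Require Import all_boot all_order all_algebra.
From mathcomp Require Import ring zify.
Import GRing.Theory.
Set Implicit Arguments.
Unset Strict Implicit.
Unset Printing Implicit Defensive.
Local Open Scope ring_scope.

(** * Substitution in non-commutative polynomials *)

(** [cd_index] is an epsilon choice, so its defining equation is available only where a solution is
    known to exist. Existence is needed for [P] and for every semisuspension, and is proved by
    dividing leading letters c and d off any coefficient function that satisfies the relations. Rank
    n is the obstacle to a common formula for all these posets: the interval below the cell tau need
    not be Boolean. Hence elements of rank n are never counted with their lower intervals; what is
    counted is the pairs formed with the next lower element of the flag ([top_pairs]). Flag words
    are read from the top rank down, since choosing an element of rank r < n leaves a Boolean
    interval of rank r, whatever the poset. For x = 0 the correction in f' is the alternating sum e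
    of (-1)^rk over the whole poset. It enters with the right sign because being semi-Eulerian
    forces e = (-1)^(n+1) e. The binomials C(n-i, n-j) occur in two roles: as the coefficient of h_i
    in f_(j-1), and as the number of faces with j vertices that sigma_i adds to the facets before
    it. *)

Section Substitution.

Variable s : bool -> ncpoly.

Lemma eq_ncsubst (p q : ncpoly) (w : seq bool) :
  p =1 q -> ncsubst s p w = ncsubst s q w.
Proof. by move=> pq; apply: eq_bigr => k _; apply: eq_bigr => m _; rewrite pq. Qed.

Lemma ncsubst_sum (I : finType) (a : I -> int) (p : I -> ncpoly) (w : seq bool) :
  ncsubst s (fun m => \sum_i a i * p i m) w = \sum_i a i * ncsubst s (p i) w.
Proof.
rewrite /ncsubst; under [RHS]eq_bigr do rewrite mulr_sumr.
rewrite exchange_big; apply: eq_bigr => k _.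
under [RHS]eq_bigr do rewrite mulr_sumr.
rewrite exchange_big; apply: eq_bigr => m _.
by rewrite mulr_suml; apply: eq_bigr => i _; rewrite mulrA.
Qed.

Lemma ncsubstB (p q : ncpoly) (w : seq bool) :
  ncsubst s (fun m => p m - q m) w = ncsubst s p w - ncsubst s q w.
Proof.
have := ncsubst_sum (fun b : bool => (-1) ^+ b) (fun b => if b then q else p) w.
rewrite !big_bool /= expr0 expr1 mul1r mulN1r addrC => <-.
by apply: eq_ncsubst => m; rewrite big_bool /= expr0 expr1 mul1r mulN1r addrC.
Qed.

Lemma ncsubstD (p q : ncpoly) (w : seq bool) :
  ncsubst s (fun m => p m + q m) w = ncsubst s p w + ncsubst s q w.
Proof.
apply/eqP; rewrite -subr_eq -ncsubstB; apply/eqP.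
by apply: eq_ncsubst => m; rewrite addrK.
Qed.

Hypothesis s0 : forall l, s l [::] = 0.

Lemma ncword_small (m w : seq bool) : (size w < size m)%N -> ncword s m w = 0.
Proof.
elim: m w => //= l m IH w wm; rewrite /ncmul big1 // => -[[|k] kw] _ /=.
  by rewrite take0 s0 mul0r.
by rewrite IH ?mulr0 // size_drop; lia.
Qed.

(** Words [m] longer than [w] contribute nothing, so the cut-off may be raised; [ncsubstE] uses this
    to give all suffixes of a word one common range. *)
Lemma ncsubst_widen (p : ncpoly) (w : seq bool) (K : nat) : (size w <= K)%N ->
  ncsubst s p w = \sum_(k < K.+1) \sum_(m : k.-tuple bool) p m * ncword s m w.
Proof.
move=> wK; rewrite /ncsubst.
pose F k : int := \sum_(m : k.-tuple bool) p m * ncword s m w.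
rewrite (big_ord_widen K.+1 F) // [RHS](bigID (fun k : 'I_K.+1 => (k < (size w).+1)%N)) /=.
rewrite [X in _ + X]big1 ?addr0 // => k; rewrite -leqNgt => wk.
by rewrite big1 // => m _; rewrite ncword_small ?mulr0 // size_tuple.
Qed.

Lemma sum_tupleS (k : nat) (F : seq bool -> int) :
  \sum_(m : k.+1.-tuple bool) F m = \sum_(l : bool) \sum_(m : k.-tuple bool) F (l :: m).
Proof.
rewrite pair_big /=.
rewrite (reindex (fun x : bool * k.-tuple bool => cons_tuple x.1 x.2)) //=.
exists (fun m => (thead m, behead_tuple m)) => [[l m] _|m _] /=.
  by congr pair; apply/val_inj.
by rewrite [RHS]tuple_eta; apply/val_inj.
Qed.

(** Horner form: a series is its constant term plus each letter times its quotient by that letter.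
    The coefficient recursions for both substitutions come from it. *)
Lemma ncsubstE (p : ncpoly) (w : seq bool) :
  ncsubst s p w =
  p [::] * ncone w + \sum_l ncmul (s l) (ncsubst s (fun m => p (l :: m))) w.
Proof.
rewrite (ncsubst_widen p (leqnSn (size w))) big_ord_recl; congr (_ + _).
  rewrite (big_pred1 [tuple]) // => m; symmetry; apply/eqP/val_inj.
  by rewrite tuple0.
under eq_bigr => k _ do rewrite (sum_tupleS _ (fun m => p m * ncword s m w)).
rewrite exchange_big; apply: eq_bigr => l _ /=.
transitivity (\sum_(j < (size w).+1) \sum_(k < (size w).+1) \sum_(m : k.-tuple bool)
    s l (take j w) * (p (l :: m) * ncword s m (drop j w))).
  rewrite exchange_big; apply: eq_bigr => k _; rewrite exchange_big.
  apply: eq_bigr => m _; rewrite /ncmul mulr_sumr; apply: eq_bigr => j _.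
  by rewrite mulrCA.
apply: eq_bigr => j _; rewrite (@ncsubst_widen _ _ (size w)) ?size_drop ?leq_subr //.
by rewrite mulr_sumr; apply: eq_bigr => k _; rewrite mulr_sumr.
Qed.

End Substitution.

Lemma ncmul_mon (u : seq bool) (q : ncpoly) (w : seq bool) :
  ncmul (ncmon u) q w = if prefix u w then q (drop (size u) w) else 0.
Proof.
rewrite /ncmul /ncmon; case: (leqP (size u) (size w)) => uw; last first.
  rewrite big1 => [|k _]; last first.
    by case: eqP => [E|]; rewrite ?mul0r //; move: uw; rewrite -E size_take; case: ifP; lia.
  by case: prefixP => // -[z E]; move: uw; rewrite E size_cat; lia.
rewrite (bigD1 (Ordinal (uw : size u < (size w).+1)%N)) //= big1 ?addr0 => [|k ku].
  rewrite prefixE; by case: eqP => _; rewrite ?mul1r ?mul0r.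
case: eqP => [E|]; rewrite ?mul0r //; case/eqP: ku; apply/val_inj => /=.
by rewrite -E size_takel // -ltnS.
Qed.

Lemma ncmulDl (p q r : ncpoly) (w : seq bool) :
  ncmul (fun u => p u + q u) r w = ncmul p r w + ncmul q r w.
Proof. by rewrite /ncmul -big_split; apply: eq_bigr => k _; rewrite mulrDl. Qed.

Lemma ncmulBl (p q r : ncpoly) (w : seq bool) :
  ncmul (fun u => p u - q u) r w = ncmul p r w - ncmul q r w.
Proof. by rewrite /ncmul -sumrB; apply: eq_bigr => k _; rewrite mulrBl. Qed.

Lemma sub_ab0 (l : bool) : sub_ab l [::] = 0. Proof. by case: l. Qed.
Lemma sub_cd0 (l : bool) : sub_cd l [::] = 0. Proof. by case: l. Qed.

Lemma ncsubst_ab_nil (p : ncpoly) : ncsubst sub_ab p [::] = p [::].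
Proof.
rewrite (ncsubstE sub_ab0) big_bool /= ncmulBl !ncmul_mon /= /ncone /ncmon /=.
by rewrite mulr1 subrr !addr0.
Qed.

Lemma ncsubst_ab_cons (p : ncpoly) (l : bool) (w : seq bool) :
  ncsubst sub_ab p (l :: w) =
  if l then ncsubst sub_ab (fun m => p (true :: m)) w
            - ncsubst sub_ab (fun m => p (false :: m)) w
  else ncsubst sub_ab (fun m => p (false :: m)) w.
Proof.
rewrite (ncsubstE sub_ab0) big_bool /= ncmulBl !ncmul_mon /= /ncone /ncmon /=.
by case: l; rewrite /= !prefix0s ?drop0 mulr0 ?add0r ?subr0.
Qed.

Lemma ncsubst_cd_nil (p : ncpoly) : ncsubst sub_cd p [::] = p [::].
Proof.
rewrite (ncsubstE sub_cd0) big_bool /= !ncmulDl !ncmul_mon /= /ncone /ncmon /=.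
by rewrite mulr1 !addr0.
Qed.

Lemma ncsubst_cd1 (p : ncpoly) (x : bool) : ncsubst sub_cd p [:: x] = p [:: false].
Proof.
rewrite (ncsubstE sub_cd0) big_bool /= !ncmulDl !ncmul_mon /= /ncone /ncmon /=.
by case: x; rewrite /= mulr0 ?add0r ?addr0 ncsubst_cd_nil.
Qed.

Lemma ncsubst_cd2 (p : ncpoly) (x y : bool) (w : seq bool) :
  ncsubst sub_cd p (x :: y :: w) =
  ncsubst sub_cd (fun m => p (false :: m)) (y :: w)
  + if x != y then ncsubst sub_cd (fun m => p (true :: m)) w else 0.
Proof.
rewrite (ncsubstE sub_cd0) big_bool /= !ncmulDl !ncmul_mon /= /ncone /ncmon /=.
by case: x; case: y; rewrite /= ?prefix0s ?drop0 mulr0 ?add0r ?addr0 // addrC.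
Qed.

(** Uniqueness of the cd-index. No word of ab + ba has two equal letters, so words beginning with aa
    or bb see only the quotient by c; once that vanishes, words beginning with ab see only the
    quotient by d. *)
Lemma ncsubst_cd_inj (p q : ncpoly) :
  ncsubst sub_cd p =1 ncsubst sub_cd q -> p =1 q.
Proof.
suff H0 (r : ncpoly) m : ncsubst sub_cd r =1 (fun _ => 0) -> r m = 0.
  move=> pq m; apply/eqP; rewrite -subr_eq0; apply/eqP.
  by apply: (H0 (fun m => p m - q m)) => w; rewrite ncsubstB pq subrr.
elim: m r => [|l m IH] r r0; first by rewrite -ncsubst_cd_nil r0.
have rc0 : ncsubst sub_cd (fun m => r (false :: m)) =1 (fun _ => 0).
  case=> [|x w]; first by rewrite ncsubst_cd_nil -(ncsubst_cd1 r false) r0.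
  by rewrite -(r0 (x :: x :: w)) ncsubst_cd2 eqxx addr0.
case: l; last exact: (IH (fun m => r (false :: m))).
apply: (IH (fun m => r (true :: m))) => w.
by rewrite -(r0 (false :: true :: w)) ncsubst_cd2 /= rc0 add0r.
Qed.

(** * Generalized Dehn-Sommerville relations and the cd-index *)

(** Left-hand side of a generalized Dehn-Sommerville (Bayer-Billera) relation: one more rank is
    inserted into a gap of [k] consecutive ranks, signed by its position. *)
Definition altsum (p : ncpoly) (u : seq bool) (k : nat) (v : seq bool) : int :=
  \sum_(j < k) (-1) ^+ j * p (u ++ nseq j false ++ true :: nseq (k.-1 - j) false ++ v).

(* [last true u] and [head true v] say that the block of [k] letters is bounded
   on each side by a [b] or by the end of the word. *)
Definition gds (p : ncpoly) : Prop := forall u k v, last true u -> head true v ->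
  altsum p u k v = (1 - (-1) ^+ k) * p (u ++ nseq k false ++ v).

Lemma altsumS (p : ncpoly) (u : seq bool) (k : nat) (v : seq bool) :
  altsum p u k.+1 v = p (u ++ true :: nseq k false ++ v) - altsum p (rcons u false) k v.
Proof.
rewrite /altsum big_ord_recl /= expr0 mul1r subn0; congr (_ + _).
rewrite -sumrN; apply: eq_bigr => j _.
rewrite /bump leq0n add1n cat_rcons exprS mulN1r mulNr /=.
by congr (- (_ * p (_ ++ _ :: _ ++ _ :: nseq _ _ ++ _))); case: k j => [[]|k j]; lia.
Qed.

(** Together with [cd_c], division by a leading d and a leading c; the change of letters behind the
    formulas is explained at [cd_of]. *)
Definition cd_d (p : ncpoly) : ncpoly :=
  fun u => p [:: true, false & u] - p [:: false, false & u] *+ 2.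

Definition cd_c (p : ncpoly) : ncpoly := fun u =>
  p (false :: u) - if u is true :: u' then cd_d p u' else 0.

Lemma altsum_d (p : ncpoly) u k v :
  altsum (cd_d p) u k v
  = altsum p [:: true, false & u] k v - altsum p [:: false, false & u] k v *+ 2.
Proof.
by rewrite /altsum -sumrMnl -sumrB; apply: eq_bigr => j _; rewrite /cd_d /=; ring.
Qed.

Lemma altsum_c (p : ncpoly) x u k v :
  altsum (cd_c p) (x :: u) k v
  = altsum p [:: false, x & u] k v - if x then altsum (cd_d p) u k v else 0.
Proof.
case: x; last by rewrite subr0 /altsum; apply: eq_bigr => j _; rewrite /cd_c subr0.
by rewrite /altsum -sumrB; apply: eq_bigr => j _; rewrite /cd_c /=; ring.
Qed.

Section Gds.

Variable p : ncpoly.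
Hypothesis gp : gds p.

(** A gap of length one below rank 2: for flag numbers, an interval of rank 2 has two middle
    elements. *)
Lemma gds_bb (u : seq bool) : p [:: true, true & u] = p [:: false, true & u] *+ 2.
Proof.
have := @gp [::] 1 (true :: u) isT isT.
by rewrite /altsum big_ord1 /= expr0 mul1r expr1 => ->; ring.
Qed.

Lemma gds_cd_d : gds (cd_d p).
Proof.
move=> [|x u] k v hu hv; rewrite altsum_d /cd_d; last first.
  by rewrite !gp //=; ring.
have := @gp [:: true] k.+1 v isT hv; rewrite altsumS /= => /(canRL (subKr _)) ->.
have := @gp [::] k.+2 v isT hv; rewrite !altsumS /= => H.
have -> : altsum p [:: false; false] k v =
  (1 - (-1) ^+ k.+2) * p [:: false, false & nseq k false ++ v]
  - p [:: true, false & nseq k false ++ v] + p [:: false, true & nseq k false ++ v].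
  by rewrite -H; ring.
by rewrite gds_bb !exprS; ring.
Qed.

Lemma gds_cd_c : gds (cd_c p).
Proof.
move=> [|x u] k v hu hv; last first.
  rewrite altsum_c gp //=; case: x hu => /= hu; last by rewrite /cd_c; ring.
  by rewrite gds_cd_d // /cd_c; ring.
case: k => [|k]; first by rewrite /altsum big_ord0 expr0 subrr mul0r.
(* Only the term with its b in first position meets the [cd_d] correction; the leading a supplied by
   [cd_c] lengthens the block to k+2. *)
rewrite altsumS altsum_c subr0 /= /cd_c /=.
have := @gp [::] k.+2 v isT hv; rewrite !altsumS /= => H.
have -> : altsum p [:: false; false] k v =
  (1 - (-1) ^+ k.+2) * p [:: false, false & nseq k false ++ v]
  - p [:: true, false & nseq k false ++ v] + p [:: false, true & nseq k false ++ v].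
  by rewrite -H; ring.
by rewrite /cd_d !exprS; ring.
Qed.

End Gds.

(* In the letters A = a - b and B = b one has c = A + 2B and d = AB + BA + 2BB.
   Hence c q + d r has A-part q + B r and B-part twice its A-part plus A r; the
   operators [cd_c] and [cd_d] recover q and r from it. *)
Fixpoint cd_of (p : ncpoly) (m : seq bool) : int :=
  match m with
  | [::] => p [::]
  | l :: m' => cd_of (if l then cd_d p else cd_c p) m'
  end.

Lemma cd_ofP (p : ncpoly) (w : seq bool) : gds p ->
  ncsubst sub_cd (cd_of p) w = ncsubst sub_ab p w.
Proof.
have [k] := ubnP (size w); elim: k => // k IH in p w *.
case: w => [|x [|y w]] /= wk gp; first by rewrite ncsubst_cd_nil ncsubst_ab_nil.
  rewrite ncsubst_cd1 ncsubst_ab_cons !ncsubst_ab_nil /= /cd_c subr0.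
  have := @gp [::] 1 [::] isT isT.
  by rewrite /altsum big_ord1 /= expr0 mul1r expr1; case: x => // ->; ring.
rewrite ncsubst_cd2 /=.
rewrite (IH (cd_c p)) ?(IH (cd_d p)) //; try exact: gds_cd_c; try exact: gds_cd_d; try lia.
(* In the letters A and B, with r = [cd_d p], the series [Xr true] is B r and [Xr false] is A r. *)
pose Xr (l : bool) : ncpoly := fun m => if m is z :: m' then
  if z == l then cd_d p m' else 0 else 0.
have XrE l : ncsubst sub_ab (Xr l) (y :: w)
   = if y == l then ncsubst sub_ab (cd_d p) w else if y then - ncsubst sub_ab (cd_d p) w else 0.
  have z0 v : ncsubst sub_ab (fun=> 0) v = 0.
    rewrite -[RHS](subrr (ncsubst sub_ab p v)) -ncsubstB.
    by apply: eq_ncsubst => m; rewrite subrr.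
  by rewrite ncsubst_ab_cons; case: (y); case: l; rewrite /Xr /= ?z0 ?subr0 ?sub0r.
have EA : ncsubst sub_ab (fun m => p (false :: m)) (y :: w)
   = ncsubst sub_ab (cd_c p) (y :: w) + ncsubst sub_ab (Xr true) (y :: w).
  rewrite -ncsubstD; apply: eq_ncsubst => -[|[] m] /=; rewrite /cd_c /=; ring.
(* The B-part is twice the A-part plus A r; one A-part is already subtracted, as in
   [ncsubst_ab_cons]. On the empty word and on words beginning with b this is a relation for a block
   of length one, on words beginning with a it is the definition of [cd_d]. *)
have EB : ncsubst sub_ab (fun m => p (true :: m)) (y :: w)
   - ncsubst sub_ab (fun m => p (false :: m)) (y :: w)
   = ncsubst sub_ab (fun m => p (false :: m)) (y :: w) + ncsubst sub_ab (Xr false) (y :: w).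
  rewrite -ncsubstD -ncsubstB; apply: eq_ncsubst => -[|[] m] /=.
  - have := @gp [::] 1 [::] isT isT.
    by rewrite /altsum big_ord1 /= expr0 mul1r expr1 => ->; ring.
  - by rewrite gds_bb //; ring.
  - by rewrite /cd_d; ring.
rewrite [RHS]ncsubst_ab_cons; case: x; rewrite ?EB EA !XrE; case: (y) => /=; ring.
Qed.

(** An epsilon choice has the chosen property as soon as some witness does; here the witness is
    [cd_of]. *)
Lemma cd_index_spec (T : finType) (le : rel T) (bot : T) (n : nat) (w : seq bool) :
  gds (chi' le bot n) ->
  ncsubst sub_cd (cd_index le bot n) w = ncsubst sub_ab (chi' le bot n) w.
Proof.
move=> gchi; pose P (Phi : ncpoly) := forall v,
  ncsubst sub_cd Phi v = ncsubst sub_ab (chi' le bot n) v.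
apply: (@epsilon_spec _ (inhabits (fun _ => 0)) P).
by exists (cd_of (chi' le bot n)) => v; exact: cd_ofP.
Qed.

(** * Flag numbers determined by the f-vector *)

Lemma sign_sq (i : nat) : (-1) ^+ i * (-1) ^+ i = 1 :> int.
Proof. by rewrite -[RHS](signrMK i) mulr1. Qed.

(** Both sides are the trinomial coefficient (a+b+c)! / (a! b! c!). *)
Lemma bin_mul_bin (a b c : nat) :
  ('C(a + b + c, a + b) * 'C(a + b, a) = 'C(a + b + c, a) * 'C(b + c, b))%N.
Proof.
have h1 := bin_fact (leq_addr c (a + b)%N).
have h2 := bin_fact (leq_addr b a).
have h3 := bin_fact (leq_addr c b).
have h4 := bin_fact (leq_addr (b + c) a).
rewrite ?addKn ?addnA in h1 h2 h3 h4.
have pos : (0 < a`! * b`! * c`!)%N by rewrite !muln_gt0 !fact_gt0.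
apply/eqP; rewrite -(eqn_pmul2r pos); apply/eqP; nia.
Qed.

Lemma alt_bin (k : nat) : \sum_(i < k.+2) (-1) ^+ i * ('C(k.+1, i))%:Z = 0 :> int.
Proof.
transitivity ((1 - 1) ^+ k.+1 : int); last by rewrite subrr expr0n.
rewrite exprDn.
by apply: eq_bigr => i _; rewrite expr1n mul1r -mulr_natr natz.
Qed.

(** Euler characteristic of the boundary of a k-simplex: the full alternating sum without its two
    extreme terms. *)
Lemma alt_bin_inner (k : nat) :
  \sum_(j < k) (-1) ^+ j * ('C(k.+1, j.+1))%:Z = 1 - (-1) ^+ k :> int.
Proof.
have := alt_bin k; rewrite big_ord_recl big_ord_recr /= bin0 binn expr0 !mulr1 /bump leq0n add1n.
have -> : \sum_(i < k) (-1) ^+ (1 + i) * ('C(k.+1, 1 + i))%:Z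
  = - \sum_(i < k) (-1) ^+ i * ('C(k.+1, i.+1))%:Z :> int.
  by rewrite -sumrN; apply: eq_bigr => i _; rewrite add1n exprS; ring.
by rewrite exprS; set S := \sum_(i < k) _; move: S ((-1) ^+ k) => S e; lia.
Qed.

(** The Dehn-Sommerville relation inside a Boolean lattice: the interval between an m-set and a
    (k+m+1)-set is Boolean of rank k+1. *)
Lemma alt_bin_bin (k m : nat) :
  \sum_(j < k) (-1) ^+ j * (('C(k + m.+1, j + m.+1))%:Z * ('C(j + m.+1, m))%:Z)
  = (1 - (-1) ^+ k) * ('C(k + m.+1, m))%:Z :> int.
Proof.
rewrite -alt_bin_inner mulr_suml; apply: eq_bigr => j _.
have jk := ltn_ord j.
have := bin_mul_bin m j.+1 (k - j).
have -> : (m + j.+1 + (k - j) = k + m.+1)%N by lia.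
have -> : (m + j.+1 = j + m.+1)%N by lia.
have -> : (j.+1 + (k - j) = k.+1)%N by lia.
by move=> H; rewrite -mulrA -!PoszM H mulnC.
Qed.

(* Here words list the ranks from the top down.  If each of the [f j]
   elements of rank [j] lies above 'C(j, i) elements of rank [i], then
   [sflags f w] is the flag number of the rank set coded by [w]. *)
Fixpoint sflags (f : nat -> int) (w : seq bool) : int :=
  match w with
  | [::] => f 0
  | l :: w' => if l then f (size w').+1 * sflags (fun i => ('C((size w').+1, i))%:Z) w'
               else sflags f w'
  end.

(* For [m > 0] the number of pairs [x < y] with [rk x = m] and [rk y = n] when all
   upper intervals [x, 1] are Eulerian. *)
Definition top_pairs (f : nat -> int) (n m : nat) : int :=
  f m - (-1) ^+ n * \sum_(l < n) (-1) ^+ l * (('C(l, m))%:Z * f l).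

(** The head of the word is rank n. If it is selected, weighting each element of rank m by the
    number of rank n elements above it turns [f] into [top_pairs f n], and the flags further down
    are counted as before. On words of length n > 0 the value [f n] never occurs. *)
Definition mflags (f : nat -> int) (n : nat) (w : seq bool) : int :=
  match w with
  | [::] => f 0
  | l :: w' => sflags (if l then top_pairs f n else f) w'
  end.

Lemma eq_sflags (f f' : nat -> int) (w : seq bool) :
  (forall j, (j <= size w)%N -> f j = f' j) -> sflags f w = sflags f' w.
Proof.
elim: w => [|l w IH] /= ff'; first exact: ff'.
case: l; first by rewrite ff'.
by apply: IH => j jw; apply: ff'; apply: leqW.
Qed.

Lemma sflags_sum (I : finType) (h : I -> int) (f : I -> nat -> int) (w : seq bool) :
  sflags (fun j => \sum_i h i * f i j) w = \sum_i h i * sflags (f i) w.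
Proof.
elim: w => //= -[] // w IH; rewrite mulr_suml; apply: eq_bigr => i _.
by rewrite mulrA.
Qed.

Lemma top_pairs_sum (I : finType) (h : I -> int) (f : I -> nat -> int) n m :
  top_pairs (fun j => \sum_i h i * f i j) n m = \sum_i h i * top_pairs (f i) n m.
Proof.
rewrite /top_pairs.
under [X in _ - _ * X]eq_bigr do rewrite !mulr_sumr.
rewrite exchange_big mulr_sumr -sumrB; apply: eq_bigr => i _ /=.
rewrite mulrBr; congr (_ - _); rewrite mulrCA; congr (_ * _).
rewrite mulr_sumr; apply: eq_bigr => l _; ring.
Qed.

Lemma eq_mflags (f f' : nat -> int) n (w : seq bool) :
  size w = n -> (0 < n)%N -> (forall j, (j < n)%N -> f j = f' j) ->
  mflags f n w = mflags f' n w.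
Proof.
case: w => [<- //|l w] /= sw n0 ff'.
apply: eq_sflags => j jw; case: l; last by apply: ff'; rewrite -sw.
rewrite /top_pairs ff' -?sw //; congr (_ - _ * _).
by apply: eq_bigr => i _; rewrite ff' // -sw.
Qed.

Lemma mflags_sum (I : finType) (h : I -> int) (f : I -> nat -> int) n (w : seq bool) :
  mflags (fun j => \sum_i h i * f i j) n w = \sum_i h i * mflags (f i) n w.
Proof.
case: w => [//|[] w] /=; last exact: sflags_sum.
by rewrite -sflags_sum; apply: eq_sflags => j _; exact: top_pairs_sum.
Qed.

Lemma sflags_nseq (f : nat -> int) (j : nat) (w : seq bool) :
  sflags f (nseq j false ++ w) = sflags f w.
Proof. by elim: j. Qed.

(** For [w] empty or beginning with b: the number of flags coded by the tail of [w] under one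
    element of rank [size w]. *)
Definition below (w : seq bool) : int := sflags (fun i => ('C(size w, i))%:Z) (behead w).

Lemma sflags_head (f : nat -> int) (w : seq bool) :
  head true w -> sflags f w = f (size w) * below w.
Proof. by case: w => [|[] w] //= _; rewrite /below /= mulr1. Qed.

Lemma sflags_block (f : nat -> int) (i j : nat) (w : seq bool) : head true w ->
  sflags f (nseq i false ++ true :: nseq j false ++ w)
  = f (j + size w).+1 * ('C((j + size w).+1, size w))%:Z * below w.
Proof.
move=> hw; rewrite sflags_nseq /= sflags_nseq sflags_head //.
by rewrite size_cat size_nseq mulrA.
Qed.

(** Mirror image of [altsum] for words read from the top down: [v] lies above the gap, [u] below it,
    and [j] still counts from the bottom of the gap. *)
Definition raltsum (g : seq bool -> int) (v : seq bool) (k : nat) (u : seq bool) : int :=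
  \sum_(j < k) (-1) ^+ j * g (v ++ nseq (k.-1 - j) false ++ true :: nseq j false ++ u).

Lemma sflags_bin_gds (k : nat) (u : seq bool) : head true u ->
  let f i := ('C(k + (size u).+1, i))%:Z in
  raltsum (sflags f) [::] k u = (1 - (-1) ^+ k) * sflags f (nseq k false ++ u).
Proof.
move=> hu f; rewrite sflags_nseq sflags_head // mulrA -alt_bin_bin mulr_suml.
by apply: eq_bigr => j _; rewrite sflags_block // /f -addnS -!mulrA.
Qed.

(** The gap is bounded above by an actual b, so everything from there down is counted in a Boolean
    interval, independently of [f]; the letters above that b only contribute a common factor. *)
Lemma sflags_gds (f : nat -> int) (x : bool) (v : seq bool) (k : nat) (u : seq bool) :
  last x v -> head true u ->
  raltsum (sflags f) (x :: v) k u = (1 - (-1) ^+ k) * sflags f (x :: v ++ nseq k false ++ u).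
Proof.
have st (g : nat -> int) w z m : size (w ++ z) = m ->
  sflags g ((true :: w) ++ z) = g m.+1 * sflags (fun i => ('C(m.+1, i))%:Z) (w ++ z).
  by move=> <-.
have sz w j : (j < k)%N ->
  size (w ++ nseq (k.-1 - j) false ++ true :: nseq j false ++ u)
  = size (w ++ nseq k false ++ u).
  by rewrite !size_cat /= !size_cat !size_nseq; lia.
elim: v x f => [|y v IH] x f hv hu; last first.
  case: x hv => hv; last exact: IH.
  rewrite -[in RHS]cat_cons (st _ _ _ _ erefl) mulrCA [in X in _ * X]cat_cons -IH // mulr_sumr.
  by apply: eq_bigr => j _; rewrite [RHS]mulrCA (st f _ _ _ (sz (y :: v) _ (ltn_ord j))).
rewrite /= in hv; rewrite {x}hv -cat_cons (st _ _ _ _ erefl) mulrCA cat0s size_cat size_nseq.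
rewrite -addnS -sflags_bin_gds // mulr_sumr; apply: eq_bigr => j _.
rewrite [RHS]mulrCA (st f _ _ (k + size u)%N) ?addnS //.
by rewrite sz ?ltn_ord // !size_cat size_nseq.
Qed.

(* [U f m = \sum_l (-1)^l 'C(l, m) f l] is an involution, and
   [top_pairs f n = f - (-1)^n U f]. *)
Lemma bin_inv (n m : nat) (f : nat -> int) : (m < n)%N ->
  \sum_(l < n) (-1) ^+ l * (('C(l, m))%:Z *
     \sum_(p < n) (-1) ^+ p * (('C(p, l))%:Z * f p)) = f m.
Proof.
move=> mn.
transitivity (\sum_(p < n) (-1) ^+ p * f p *
   \sum_(l < n) (-1) ^+ l * (('C(p, l))%:Z * ('C(l, m))%:Z)).
  under eq_bigr do rewrite !mulr_sumr.
  rewrite exchange_big; apply: eq_bigr => p _; rewrite mulr_sumr.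
  by apply: eq_bigr => l _; ring.
rewrite (bigD1 (Ordinal mn)) //= [X in _ + X]big1 => [|p pm].
  rewrite (bigD1 (Ordinal mn)) //= big1 => [|l lm].
    by rewrite !binn addr0 -[RHS](signrMK m); ring.
  have: (l != m :> nat) by rewrite -[m]/(val (Ordinal mn)) val_eqE.
  case: (ltngtP l m) => // lm' _; first by rewrite (@bin_small l m) // !mulr0.
  by rewrite (@bin_small m l) // mul0r mulr0.
case: (ltnP p m) => [pm'|mp].
  rewrite big1 ?mulr0 // => l _; case: (ltnP p l) => [pl|lp].
    by rewrite bin_small // mul0r mulr0.
  by rewrite (@bin_small l m) ?mulr0 //; lia.
have {pm}mp' : (m < p)%N.
  by rewrite ltn_neqAle mp andbT eq_sym -[m]/(val (Ordinal mn)) val_eqE.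
rewrite -(big_mkord xpredT (fun l => (-1) ^+ l * (('C(p, l))%:Z * ('C(l, m))%:Z))).
have pn := ltn_ord p.
rewrite (@big_cat_nat _ _ _ m) //=; last lia.
rewrite big_nat_cond big1 ?add0r => [|l /andP[/andP[_ lm] _]]; last first.
  by rewrite (@bin_small l m) ?mulr0.
rewrite (@big_cat_nat _ _ _ p.+1) //=; try lia.
rewrite [X in _ + X]big_nat_cond [X in _ + X]big1 ?addr0 => [|l /andP[/andP[pl _] _]]; last first.
  by rewrite bin_small // mul0r mulr0.
(* C(p, l) C(l, m) = C(p, m) C(p-m, l-m), which leaves an alternating row sum; p - m is written as a
   successor because row 0 does not sum to zero. *)
have -> : \sum_(m <= l < p.+1) (-1) ^+ l * (('C(p, l))%:Z * ('C(l, m))%:Z)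
   = (-1) ^+ m * (('C(p, m))%:Z * \sum_(i < (p - m).-1.+2) (-1) ^+ i * ('C((p - m).-1.+1, i))%:Z).
  rewrite -{1}[m]add0n big_addn big_mkord.
  have -> : (p.+1 - m = (p - m).-1.+2)%N by lia.
  rewrite !mulr_sumr; apply: eq_bigr => i _.
  have := bin_mul_bin m i (p - m - i); have := ltn_ord i => ip.
  have -> : (m + i + (p - m - i) = p)%N by lia.
  have -> : (i + (p - m - i) = p - m)%N by lia.
  have -> : 'C((p - m).-1.+1, i) = 'C(p - m, i) by congr 'C(_, _); lia.
  move=> H; rewrite (addnC i m).
  by rewrite -PoszM H PoszM exprD; ring.
by rewrite alt_bin !mulr0.
Qed.

(** Since U is an involution, t = f - (-1)^n U f satisfies U t = -(-1)^n t. Splitting off the term l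
    = m of U t gives the relation for the gap between rank m and a selected rank n. *)
Lemma alt_top_pairs (f : nat -> int) (k m : nat) :
  \sum_(j < k) (-1) ^+ j *
     (top_pairs f (k + m.+1) (j + m).+1 * ('C((j + m).+1, m))%:Z)
  = (1 - (-1) ^+ k) * top_pairs f (k + m.+1) m.
Proof.
set n := (k + m.+1)%N; set t := top_pairs f n.
have Ut : \sum_(l < n) (-1) ^+ l * (('C(l, m))%:Z * t l) = - (-1) ^+ n * t m.
  rewrite {1}/t /top_pairs.
  under eq_bigr do rewrite !mulrBr.
  rewrite sumrB.
  have -> : \sum_(l < n) (-1) ^+ l * (('C(l, m))%:Z * ((-1) ^+ n *
     \sum_(p < n) (-1) ^+ p * (('C(p, l))%:Z * f p))) = (-1) ^+ n * f m.
    rewrite -[in RHS](@bin_inv n m f); last by rewrite /n; lia.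
    by rewrite mulr_sumr; apply: eq_bigr => l _; ring.
  rewrite /t /top_pairs; set S := \sum_(l < n) _.
  by rewrite -[X in X - _ = _](signrMK n); ring.
have Es : \sum_(l < n) (-1) ^+ l * (('C(l, m))%:Z * t l)
  = (-1) ^+ m * t m - (-1) ^+ m * \sum_(j < k) (-1) ^+ j * (t (j + m).+1 * ('C((j + m).+1, m))%:Z).
  rewrite -(big_mkord xpredT (fun l => (-1) ^+ l * (('C(l, m))%:Z * t l))).
  rewrite (@big_cat_nat _ _ _ m) //=; last by rewrite /n; lia.
  rewrite big_nat_cond big1 ?add0r => [|l /andP[/andP[_ lm] _]]; last first.
    by rewrite bin_small // mul0r mulr0.
  rewrite big_ltn ?binn ?mul1r; last by rewrite /n; lia.
  congr (_ + _); rewrite -{1}[m.+1]add0n big_addn big_mkord.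
  have -> : (n - m.+1 = k)%N by rewrite /n; lia.
  rewrite mulr_sumr -sumrN; apply: eq_bigr => j _.
  by rewrite addnS exprS exprD; ring.
set X := \sum_(j < k) _.
have : (-1) ^+ m * X = (-1) ^+ m * t m + (-1) ^+ n * t m.
  move: Ut; rewrite Es -/X mulNr.
  by move: (_ * X) (_ * t m) (_ * t m) => a b c; lia.
move=> H; rewrite -[LHS](signrMK m) H /n addnS exprS exprD.
transitivity ((-1) ^+ m * (-1) ^+ m * ((1 - (-1) ^+ k) * t m)); first ring.
by rewrite sign_sq mul1r.
Qed.

(** If the gap contains rank n, the relation is the definition of [top_pairs]; if rank n is the b
    bounding the gap, it is [alt_top_pairs]; if the bounding b lies lower, the gap sits in a Boolean
    interval and [sflags_gds] applies. *)
Lemma mflags_gds (f : nat -> int) (n k : nat) (v u : seq bool) :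
  last true v -> head true u -> (size v + k + size u = n)%N ->
  raltsum (mflags f n) v k u = (1 - (-1) ^+ k) * mflags f n (v ++ nseq k false ++ u).
Proof.
case: k => [|k]; first by rewrite /raltsum big_ord0 expr0 subrr mul0r.
case: v => [|l [|y v]] /= hv hu sz.
- rewrite sflags_nseq sflags_head // /raltsum big_ord_recr /= subnn /=.
  rewrite sflags_nseq sflags_head // /top_pairs.
  set m := size u in sz *.
  have -> : \sum_(i < k) (-1) ^+ i * mflags f n (nseq (k - i) false ++ true :: nseq i false ++ u)
    = (\sum_(i < k) (-1) ^+ i * (('C((i + m).+1, m))%:Z * f (i + m).+1)) * below u.
    rewrite mulr_suml; apply: eq_bigr => i _; have ik := ltn_ord i.
    rewrite (_ : (k - i = (k - i.+1).+1)%N) /=; last lia.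
    by rewrite sflags_block // -/m; ring.
  set Y := \sum_(i < k) _.
  have -> : \sum_(l < n) (-1) ^+ l * (('C(l, m))%:Z * f l) = (-1) ^+ m * f m - (-1) ^+ m * Y.
    rewrite -(big_mkord xpredT (fun l => (-1) ^+ l * (('C(l, m))%:Z * f l))).
    rewrite (@big_cat_nat _ _ _ m) //=; last by lia.
    rewrite big_nat_cond big1 ?add0r => [|l /andP[/andP[_ lm] _]]; last first.
      by rewrite bin_small // mul0r mulr0.
    rewrite big_ltn ?binn ?mul1r; last by lia.
    congr (_ + _); rewrite -{1}[m.+1]add0n big_addn big_mkord.
    have -> : (n - m.+1 = k)%N by lia.
    rewrite mulr_sumr -sumrN; apply: eq_bigr => j _.
    by rewrite addnS exprS exprD; ring.
  have nE : n = (k.+1 + m)%N by lia.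
  rewrite nE exprD exprS.
  rewrite (_ : (-1) ^+ k * ((f m - -1 * (-1) ^+ k * (-1) ^+ m * ((-1) ^+ m * f m - (-1) ^+ m * Y)) * below u)
   = ((-1) ^+ k * f m + (-1) ^+ k * (-1) ^+ k * ((-1) ^+ m * (-1) ^+ m) * (f m - Y)) * below u); last ring.
  by rewrite !sign_sq; ring.
- rewrite hv /raltsum /= sflags_nseq sflags_head //.
  have nE : n = (k.+1 + (size u).+1)%N by lia.
  rewrite nE mulrA -alt_top_pairs mulr_suml; apply: eq_bigr => j _.
  by rewrite sflags_block // mulrA.
- by case: l; rewrite -(sflags_gds _ _ hv hu).
Qed.

Lemma gds_mflags (f : nat -> int) (n : nat) :
  gds (fun w => if size w == n then mflags f n (rev w) else 0).
Proof.
move=> u k v hu hv; rewrite /altsum.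
have szE j : (j < k)%N -> size (u ++ nseq j false ++ true :: nseq (k.-1 - j) false ++ v)
   = size (u ++ nseq k false ++ v).
  by rewrite !size_cat /= !size_cat !size_nseq; lia.
under eq_bigr => j _ do rewrite szE //.
case: eqP => [sz|_]; last by rewrite big1 ?mulr0 // => j _; rewrite mulr0.
rewrite !rev_cat rev_nseq -catA -mflags_gds ?size_rev.
- apply: eq_bigr => j _; congr (_ * mflags _ _ _).
  by rewrite !rev_cat rev_cons rev_cat !rev_nseq cat_rcons -!catA.
- by case: v hv {sz szE} => //= x v; rewrite rev_cons last_rcons.
- by case/lastP: u hu {sz szE} => //= u x; rewrite last_rcons rev_rcons.
- by rewrite -sz !(size_cat, size_nseq); lia.
Qed.

(** * Rank and flags of a finite poset *)

Section Rank.

Variables (T : finType) (le : rel T) (bot : T).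
Hypothesis le_refl : reflexive le.
Hypothesis le_anti : antisymmetric le.
Hypothesis le_trans : transitive le.
Hypothesis le0x : forall x, le bot x.

Let rkchain x (C : {set T}) :=
  is_chain le C && (C \subset [set y | le bot y && le y x]).

Lemma is_chainP (C : {set T}) :
  reflect {in C &, forall x y, le x y || le y x} (is_chain le C).
Proof.
apply: (iffP forall_inP) => [H x y xC yC|H x xC]; first exact: (forall_inP (H x xC)).
by apply/forall_inP => y; exact: H.
Qed.

Lemma ltE x y : lt le x y = (x != y) && le x y. Proof. by []. Qed.

Lemma lt_le_trans x y z : lt le x y -> le y z -> lt le x z.
Proof.
rewrite !ltE => /andP[xy lxy] lyz; rewrite (le_trans lxy lyz) andbT.
by apply: contra xy => /eqP E; rewrite (@le_anti x y) // lxy E.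
Qed.

Lemma le_lt_trans x y z : le x y -> lt le y z -> lt le x z.
Proof.
rewrite !ltE => lxy /andP[yz lyz]; rewrite (le_trans lxy lyz) andbT.
by apply: contra yz => /eqP E; rewrite (@le_anti y z) // lyz -E.
Qed.

Lemma lt_irr x : lt le x x = false. Proof. by rewrite ltE eqxx. Qed.

Lemma rk_chain x : exists2 C : {set T}, rkchain x C & #|C| = (rk le bot x).+1.
Proof.
have c1 : rkchain x [set bot].
  apply/andP; split; first by apply/is_chainP => y z /set1P-> /set1P->; rewrite le_refl.
  by apply/subsetP => y /set1P->; rewrite inE le_refl le0x.
have [|C cC E] := @eq_bigmax_cond _ (rkchain x) (fun C : {set T} => #|C|).
  by apply/card_gt0P; exists [set bot].
have := @leq_bigmax_cond _ (rkchain x) (fun C : {set T} => #|C|) _ c1.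
rewrite cards1 => pos; exists C => //.
by rewrite /rk prednK // -E.
Qed.

Lemma rk_max x (C : {set T}) : rkchain x C -> (#|C| <= (rk le bot x).+1)%N.
Proof.
move=> cC; have := @leq_bigmax_cond _ (rkchain x) (fun C : {set T} => #|C|) _ cC.
rewrite /rk => H; apply: (leq_trans H); exact: leqSpred.
Qed.

Lemma rk_lt x y : lt le x y -> (rk le bot x < rk le bot y)%N.
Proof.
move=> ltxy; have [C /andP[/is_chainP cC /subsetP sC] E] := rk_chain x.
have le_y z : z \in C -> lt le z y.
  by move=> /sC; rewrite inE => /andP[_ lzx]; apply: le_lt_trans lzx ltxy.
have yC : y \notin C by apply/negP => /le_y; rewrite lt_irr.
have cardyC : #|y |: C| = (rk le bot x).+2 by rewrite cardsU1 yC E.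
rewrite -ltnS -cardyC; apply: rk_max; apply/andP; split.
  apply/is_chainP => a b /setU1P[->|aC] /setU1P[->|bC]; rewrite ?le_refl //.
  - by have /andP[_ ->] := le_y _ bC; rewrite orbT.
  - by have /andP[_ ->] := le_y _ aC.
  - exact: cC.
apply/subsetP => a /setU1P[->|aC]; rewrite inE le0x ?le_refl //.
by have /andP[_ ->] := le_y _ aC.
Qed.

Lemma rk_le x y : le x y -> (rk le bot x <= rk le bot y)%N.
Proof. by case: (eqVneq x y) => [->//|xy lxy]; rewrite ltnW // rk_lt // ltE xy. Qed.

(** Strict growth makes [rho] injective on chains and so bounds their length; the step property
    allows a descent by single ranks, giving the reverse bound. Both are asked only below [x], so
    that the lemma applies to one interval at a time. *)
Lemma rk_unique (rho : T -> nat) (x : T) :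
  (forall y z, le z x -> lt le y z -> (rho y < rho z)%N) ->
  (forall z, le z x -> (0 < rho z)%N -> exists2 y, lt le y z & (rho y).+1 = rho z) ->
  rk le bot x = rho x.
Proof.
move=> rho_lt rho_step.
have rho_inj y z : le y x -> le z x -> le y z || le z y -> rho y = rho z -> y = z.
  move=> yx zx cmp E; apply/eqP/negPn/negP => yz.
  case/orP: cmp => l; [have := rho_lt y z zx | have := rho_lt z y yx].
    by rewrite ltE yz l E ltnn => /(_ isT).
  by rewrite ltE eq_sym yz l E ltnn => /(_ isT).
apply/eqP; rewrite eqn_leq; apply/andP; split; last first.
  suff H m z : le z x -> rho z = m -> (m <= rk le bot z)%N by exact: (H _ x).
  elim: m z => // m IH z zx rz.
  have [|y yz ry] := rho_step z zx; first by rewrite rz.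
  have yx : le y x by move: yz; rewrite ltE => /andP[_ yz]; exact: le_trans zx.
  by apply: leq_ltn_trans (rk_lt yz); apply: IH => //; lia.
have [C /andP[/is_chainP cC /subsetP sC] E] := rk_chain x.
have le_x z : z \in C -> le z x by move=> /sC; rewrite inE => /andP[].
have rho_x z : le z x -> (rho z < (rho x).+1)%N.
  case: (eqVneq z x) => [-> //|zx lzx]; apply/ltnW.
  by rewrite ltnS rho_lt // ?le_refl // ltE zx.
rewrite -ltnS -E -(card_ord (rho x).+1).
rewrite -(card_in_imset (f := fun z => inord (rho z) : 'I_(rho x).+1)) ?max_card //.
move=> y z yC zC /(congr1 val); rewrite /= !inordK ?rho_x ?le_x //.
by apply: rho_inj; rewrite ?le_x // cC.
Qed.


Lemma rk_eq0 x : (rk le bot x == 0%N) = (x == bot).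
Proof.
have r0 : rk le bot bot = 0%N.
  apply: (@rk_unique (fun=> 0%N)) => // y z z0; rewrite (@le_anti z bot) ?z0 ?le0x //.
  by rewrite ltE => /andP[y0 ly0]; case/eqP: y0; apply: le_anti; rewrite ly0 le0x.
case: (eqVneq x bot) => [->|x0]; first by rewrite r0.
by apply/negbTE; rewrite -lt0n -r0 rk_lt // ltE eq_sym x0 le0x.
Qed.

End Rank.

Section Flags.

Variables (T : finType) (le : rel T) (bot top : T).
Hypothesis le_refl : reflexive le.
Hypothesis le_anti : antisymmetric le.
Hypothesis le_trans : transitive le.
Hypothesis le0x : forall x, le bot x.
Local Notation rk := (rk le bot).
Local Notation lt := (lt le).
Let rk_lt := rk_lt le_refl le_anti le_trans le0x.

Lemma chain_rk_inj (C : {set T}) : is_chain le C -> {in C &, injective rk}.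
Proof.
move=> /is_chainP cC x y xC yC E; apply/eqP/negPn/negP => xy.
case/orP: (cC _ _ xC yC) => l.
  by have := @rk_lt x y; rewrite ltE xy l E ltnn => /(_ isT).
by have := @rk_lt y x; rewrite ltE eq_sym xy l E ltnn => /(_ isT).
Qed.

Fixpoint nchains (x : T) (w : seq bool) : int :=
  match w with
  | [::] => 1
  | l :: w' => if l then \sum_(y | lt y x && (rk y == (size w').+1)) nchains y w'
               else nchains x w'
  end.

(* As the word [w] lists the ranks from the top down, rank [j] sits at position
   [j - 1] of [rev w]. *)
Definition rank_in (w : seq bool) (j : nat) : bool := (0 < j)%N && nth false (rev w) j.-1.

Lemma rank_in_cons l w j : rank_in (l :: w) j = rank_in w j || l && (j == (size w).+1).
Proof.
rewrite /rank_in rev_cons nth_rcons size_rev; case: j => [|j] /=; first by rewrite andbF.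
rewrite eqSS; case: (ltngtP j (size w)) => [jw|jw|->].
- by rewrite andbF orbF.
- by rewrite nth_default ?size_rev ?andbF // ltnW.
- by rewrite nth_default ?size_rev // andbT.
Qed.

Lemma rank_in_le w j : rank_in w j -> (j <= size w)%N.
Proof.
case/andP=> j0; case: (leqP j (size w)) => // wj.
by rewrite nth_default // size_rev -ltnS prednK.
Qed.

Definition flags_below (x : T) (w : seq bool) : {set {set T}} :=
  [set C : {set T} | [&& is_chain le C, [forall y in C, lt y x && rank_in w (rk y)]
     & [forall j : 'I_(size w).+1, rank_in w j ==> [exists y in C, rk y == j]]]].

Lemma flags_belowP x w (C : {set T}) :
  reflect [/\ is_chain le C, {in C, forall y, lt y x /\ rank_in w (rk y)}
     & forall j, rank_in w j -> exists2 y, y \in C & rk y = j] (C \in flags_below x w).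
Proof.
rewrite inE; apply: (iffP and3P) => -[cC H1 H2]; split => //.
- by move=> y yC; apply/andP/(forall_inP H1).
- move=> j wj; have jw := rank_in_le wj.
  have /implyP/(_ wj)/exists_inP[y yC /eqP yj] := forallP H2 (Ordinal (jw : (j < (size w).+1)%N)).
  by exists y.
- by apply/forall_inP => y /H1/andP.
- apply/forallP => j; apply/implyP => /H2[y yC yj]; apply/exists_inP.
  by exists y => //; apply/eqP.
Qed.

Lemma flags_below_false x w : flags_below x (false :: w) = flags_below x w.
Proof.
apply/setP => C; apply/flags_belowP/flags_belowP => -[cC H1 H2]; split => //.
- by move=> y /H1[yx]; rewrite rank_in_cons orbF.
- by move=> j wj; apply: H2; rewrite rank_in_cons wj.
- by move=> y /H1[yx wy]; rewrite rank_in_cons wy.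
- by move=> j; rewrite rank_in_cons orbF; exact: H2.
Qed.

(** In such a chain [y] has the largest rank, so the remaining elements, being comparable to it, lie
    below it; adding and removing [y] are then inverse. *)
Lemma flags_below_true x y w : lt y x -> rk y = (size w).+1 ->
  [set C in flags_below x (true :: w) | y \in C] = [set y |: C | C in flags_below y w].
Proof.
move=> yx ry; apply/setP => C; rewrite inE; apply/andP/imsetP.
  case=> /flags_belowP[cC H1 H2] yC; exists (C :\ y); last by rewrite setD1K.
  have below z : z \in C -> z != y -> lt z y /\ rank_in w (rk z).
    move=> zC zy; have [_] := H1 z zC; rewrite rank_in_cons /= -ry.
    have rzy : rk z != rk y.
      by apply: contra zy => /eqP E; apply/eqP; exact: (chain_rk_inj cC zC yC E).
    rewrite (negbTE rzy) orbF => wz; split => //; rewrite ltE zy /=.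
    have /orP[//|yz] := is_chainP _ _ cC _ _ zC yC.
    have := @rk_lt y z; rewrite ltE eq_sym zy yz ry => /(_ isT).
    by have := rank_in_le wz; lia.
  apply/flags_belowP; split.
  - apply/is_chainP => a b /setD1P[_ aC] /setD1P[_ bC]; exact: (is_chainP _ _ cC).
  - by move=> z /setD1P[zy zC]; exact: below.
  - move=> j wj; have [|z zC rz] := H2 j; first by rewrite rank_in_cons wj.
    exists z => //; rewrite in_setD1 zC andbT; apply/eqP => zy.
    by have := rank_in_le wj; rewrite -rz zy ry ltnn.
case=> C' /flags_belowP[cC H1 H2] ->; split; last by rewrite setU11.
apply/flags_belowP; split.
- apply/is_chainP => a b /setU1P[->|aC] /setU1P[->|bC]; rewrite ?le_refl //.
  + by have [/andP[_ ->] _] := H1 _ bC; rewrite orbT.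
  + by have [/andP[_ ->] _] := H1 _ aC.
  + exact: (is_chainP _ _ cC).
- move=> z /setU1P[->|zC]; rewrite rank_in_cons; first by rewrite ry eqxx orbT.
  have [zy ->] := H1 z zC; split => //.
  by move/andP: yx => [_ lyx]; exact: (lt_le_trans le_anti le_trans zy lyx).
- move=> j; rewrite rank_in_cons => /orP[/H2[z zC rz]|/eqP ->].
    by exists z => //; rewrite setU1r.
  by exists y => //; rewrite setU11.
Qed.

Lemma card_flags_below x w : (#|flags_below x w|)%:Z = nchains x w.
Proof.
elim: w x => [|[] w IH] x /=; last by rewrite flags_below_false.
  rewrite (_ : flags_below x [::] = [set set0]) ?cards1 //.
  apply/setP => C; rewrite in_set1; apply/flags_belowP/eqP => [[_ H _]|->].
    by apply/setP => y; rewrite in_set0; apply/negP => /H[_]; rewrite /rank_in nth_nil andbF.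
  split=> [|y|j]; rewrite ?in_set0 //; last by rewrite /rank_in nth_nil andbF.
  by apply/is_chainP => y z; rewrite in_set0.
(* The inner sum is 1: a flag has exactly one element of its top rank. *)
transitivity (\sum_(C in flags_below x (true :: w))
    \sum_(y | lt y x && (rk y == (size w).+1)) (y \in C)%:Z).
  rewrite -sum1_card -[Posz _]natz natr_sum; apply: eq_bigr => C /flags_belowP[cC H1 H2].
  have [|y yC ry] := H2 (size w).+1; first by rewrite rank_in_cons /= eqxx orbT.
  have [yx _] := H1 y yC.
  rewrite (bigD1 y) /=; last by rewrite yx ry eqxx.
  rewrite yC big1 ?addr0 // => z /andP[/andP[_ /eqP rz] zy].
  case: (boolP (z \in C)) => // zC; case/eqP: zy.
  by apply: (chain_rk_inj cC) => //; rewrite rz.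
rewrite exchange_big; apply: eq_bigr => y /andP[yx /eqP ry] /=.
rewrite -IH -(card_in_imset (f := fun C => y |: C)); last first.
  move=> C D /flags_belowP[_ HC _] /flags_belowP[_ HD _] E.
  have yn (B : {set T}) : {in B, forall z, lt z y /\ rank_in w (rk z)} -> y \notin B.
    by move=> HB; apply/negP => /HB[]; rewrite lt_irr.
  by rewrite -(setU1K (yn _ HC)) E setU1K // yn.
rewrite -(flags_below_true yx ry) -sum1dep_card -[Posz _]natz natr_sum /=.
rewrite [RHS]big_mkcondr; apply: eq_bigr => C _.
by case: (y \in C).
Qed.

Lemma size_uS n (S : {set 'I_n}) : size (uS S) = n.
Proof. by rewrite /uS size_map size_enum_ord. Qed.

Lemma nth_uS n (S : {set 'I_n}) (i : 'I_n) : nth false (uS S) i = (i \in S).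
Proof. by rewrite /uS (nth_map i) ?size_enum_ord // nth_ord_enum. Qed.

Lemma rank_in_uS n (S : {set 'I_n}) j :
  reflect (exists2 i, i \in S & j = (val i).+1) (rank_in (rev (uS S)) j).
Proof.
rewrite /rank_in revK; case: j => [|j] /=; first by constructor; case.
case: (ltnP j n) => [jn|nj]; last first.
  by rewrite nth_default ?size_uS //; constructor; case=> i _ [E]; have := ltn_ord i; lia.
rewrite -[j in nth _ _ j]/(val (Ordinal jn)) nth_uS; apply: (iffP idP) => [iS|[i iS [E]]].
  by exists (Ordinal jn).
by rewrite (_ : Ordinal jn = i) //; apply/val_inj.
Qed.

Lemma flag_f_nchains n (S : {set 'I_n}) :
  (forall x, le x top) -> rk top = n.+1 ->
  (flag_f le bot S)%:Z = nchains top (rev (uS S)).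
Proof.
move=> lex1 rk1; rewrite -card_flags_below /flag_f; congr (Posz #|pred_of_set _|).
apply/setP => C; rewrite inE; apply/and4P/flags_belowP.
  case=> cC _ H1 H2; split => //.
    move=> y yC; have /exists_inP[i iS /eqP ry] := forall_inP H1 y yC; split.
      rewrite ltE lex1 andbT; apply/eqP => E; move: ry; rewrite E rk1 => -[ni].
      by have := ltn_ord i; move: ni => /=; lia.
    by apply/rank_in_uS; exists i.
  move=> j /rank_in_uS[i iS ->].
  by have /exists_inP[y yC /eqP ry] := forall_inP H2 i iS; exists y.
case=> cC H1 H2; split => //.
(* Ranks are injective on a chain, so [C] and [S] both have as many elements as their common set of
   ranks, taken in ['I_n.+2]. *)
- have rn y : y \in C -> (rk y < n.+2)%N.
    by move=> /H1[_ /rank_in_uS[i _ ->]]; have := ltn_ord i; rewrite /=; lia.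
  apply/eqP; rewrite -(card_in_imset (f := fun y => inord (rk y) : 'I_n.+2)); last first.
    move=> y z yC zC /(congr1 val); rewrite /= !inordK ?rn //.
    by apply: (chain_rk_inj cC).
  rewrite -[RHS](card_in_imset (f := fun i : 'I_n => inord (val i).+1 : 'I_n.+2)); last first.
    move=> i j _ _ /(congr1 val); have := ltn_ord i; have := ltn_ord j => hi hj.
    by rewrite /= !inordK; [case=> /val_inj | rewrite /=; lia | rewrite /=; lia].
  apply: eq_card => k; apply/imsetP/imsetP => -[y yC ->].
    by have [_ /rank_in_uS[i iS ->]] := H1 y yC; exists i.
  have [|z zC rz] := H2 (val y).+1; first by apply/rank_in_uS; exists y.
  by exists z; rewrite ?rz.
- apply/forall_inP => y yC; have [_ /rank_in_uS[i iS ry]] := H1 y yC.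
  by apply/exists_inP; exists i; rewrite // ry.
- apply/forall_inP => i iS; have [|y yC ry] := H2 (val i).+1; first by apply/rank_in_uS; exists i.
  by apply/exists_inP; exists y; rewrite // ry.
Qed.

End Flags.

(** * Posets with Boolean lower and Eulerian upper intervals *)

Section SimplicialFlags.

Variables (T : finType) (le : rel T) (bot top : T) (n : nat).
Hypothesis le_refl : reflexive le.
Hypothesis le_anti : antisymmetric le.
Hypothesis le_trans : transitive le.
Hypothesis le0x : forall x, le bot x.
Hypothesis lex1 : forall x, le x top.
Local Notation rk := (rk le bot).
Local Notation lt := (lt le).
Hypothesis n_gt0 : (0 < n)%N.
Hypothesis rk1 : rk top = n.+1.
(** Restricted to ranks below n so that it also holds for the semisuspensions, where the cell tau
    has rank n. *)
Hypothesis card_below : forall y j, (rk y < n)%N ->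
  #|[set z | le z y && (rk z == j)]| = 'C(rk y, j).
Hypothesis euler_above : forall x, x != bot -> (rk x < n)%N ->
  \sum_(z | le x z) (-1) ^+ rk z = 0 :> int.
(** For even n this says that the alternating sum is zero; for odd n it leaves the sum free, as for
    manifolds of even dimension. *)
Hypothesis euler_all : \sum_z (-1) ^+ rk z = (-1) ^+ n.+1 * \sum_z (-1) ^+ rk z :> int.

Let rk_lt := rk_lt le_refl le_anti le_trans le0x.
Let rk_le := rk_le le_refl le_anti le_trans le0x.

Definition rank_num (T : finType) (le : rel T) (bot : T) (j : nat) : int :=
  (#|[set x | Defs.rk le bot x == j]|)%:Z.
Local Notation f := (rank_num le bot).

Let rk_eq0 := rk_eq0 le_refl le_anti le_trans le0x.

Lemma rank_num0 : f 0 = 1.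
Proof.
by rewrite /rank_num (_ : [set x | _] = [set bot]) ?cards1 //; apply/setP => x; rewrite !inE rk_eq0.
Qed.

Lemma rk_top_eq x : (rk x == n.+1) = (x == top).
Proof.
apply/eqP/eqP => [rx|->//]; apply/eqP/negPn/negP => xt.
by have := @rk_lt x top; rewrite ltE xt lex1 rx rk1 ltnn => /(_ isT).
Qed.

Lemma rk_le_top x : (rk x <= n.+1)%N.
Proof. by rewrite -rk1; apply: rk_le. Qed.

Lemma card_lt y j : (rk y < n)%N -> (j < rk y)%N ->
  #|[set z | lt z y && (rk z == j)]| = 'C(rk y, j).
Proof.
move=> yn jy; rewrite -card_below //; apply: eq_card => z; rewrite !inE ltE -andbA.
by case: eqVneq => [->|//]; rewrite (gtn_eqF jy) andbF.
Qed.

Lemma sum_const_rank (P : pred T) j (F : T -> int) c :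
  (forall z, P z -> rk z = j -> F z = c) ->
  \sum_(z | P z && (rk z == j)) F z = (#|[set z | P z && (rk z == j)]|)%:Z * c.
Proof.
move=> Fc; transitivity (\sum_(z | P z && (rk z == j)) c).
  by apply: eq_bigr => z /andP[Pz /eqP]; exact: Fc.
by rewrite sumr_const cardsE -mulr_natl natz.
Qed.

Lemma nchains_below y w : (rk y < n)%N -> (size w < rk y)%N ->
  nchains le bot y w = sflags (fun i => ('C(rk y, i))%:Z) w.
Proof.
elim: w y => [|[] w IH] y yn wy /=; [by rewrite bin0| |by apply: IH => //; apply: ltnW].
rewrite (@sum_const_rank _ _ _ (sflags (fun i => ('C((size w).+1, i))%:Z) w)); last first.
  by move=> z _ rz; rewrite IH rz //; apply: ltn_trans wy yn.
by rewrite card_lt.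
Qed.

Lemma card_lt_top j : (j <= n)%N -> #|[set z | lt z top && (rk z == j)]|%:Z = f j.
Proof.
move=> jn; congr Posz; apply: eq_card => z; rewrite !inE ltE lex1 andbT.
case: eqVneq => [->|//]; rewrite rk1; symmetry; apply/negbTE; lia.
Qed.

Lemma nchains_top w : (size w < n)%N -> nchains le bot top w = sflags f w.
Proof.
elim: w => [|[] w IH] wn /=; [by rewrite rank_num0| |by apply: IH; apply: ltnW].
rewrite (@sum_const_rank _ _ _ (sflags (fun i => ('C((size w).+1, i))%:Z) w)); last first.
  by move=> z _ rz; rewrite nchains_below rz.
by rewrite card_lt_top // ltnW.
Qed.

Lemma sum_rk (P : pred T) :
  \sum_(z | P z) (-1) ^+ rk z
  = \sum_(l < n.+2) (-1) ^+ l * (#|[set z | P z && (rk z == l)]|)%:Z :> int.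
Proof.
have rn z : (rk z < n.+2)%N by rewrite ltnS rk_le_top.
rewrite (partition_big (fun z => Ordinal (rn z)) xpredT) //=; apply: eq_bigr => l _.
rewrite mulrC -(@sum_const_rank P l (fun z => (-1) ^+ rk z)); last by move=> z _ ->.
by apply: eq_bigl => z; rewrite -val_eqE.
Qed.

Definition rank_pairs m : int :=
  \sum_(x | rk x == m) (#|[set y | le x y && (rk y == n)]|)%:Z.

(** Double counting by the upper element: one of rank l < n lies above C(l, m) elements of rank m,
    the top lies above all of them, and only the pairs reaching rank n stay unknown. *)
Lemma sum_above m : (m < n)%N ->
  \sum_(x | rk x == m) \sum_(z | le x z) (-1) ^+ rk z
  = \sum_(l < n) (-1) ^+ l * (('C(l, m))%:Z * f l)
    + (-1) ^+ n * rank_pairs m - (-1) ^+ n * f m :> int.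
Proof.
move=> mn; under eq_bigr do rewrite sum_rk.
rewrite exchange_big !big_ord_recr /=; congr (_ + _ + _).
- apply: eq_bigr => l _; rewrite -mulr_sumr; congr (_ * _).
  transitivity (\sum_(x | rk x == m) \sum_(y | rk y == l) (le x y)%:Z).
    apply: eq_bigr => x _; rewrite -sum1dep_card -[Posz _]natz natr_sum /=.
    rewrite [LHS]big_mkcond [RHS]big_mkcond; apply: eq_bigr => y _.
    by case: (le x y); case: (rk y == l).
  rewrite exchange_big /=.
  transitivity (\sum_(y | rk y == l) ('C(l, m))%:Z).
    apply: eq_bigr => y /eqP ry; rewrite -ry -card_below ?ry //.
    rewrite -sum1dep_card -[Posz _]natz natr_sum /=.
    rewrite [LHS]big_mkcond [RHS]big_mkcond; apply: eq_bigr => x _.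
    by case: (le x y); case: (rk x == m).
  by rewrite sumr_const -mulr_natr natz /rank_num cardsE.
- by rewrite -mulr_sumr.
- rewrite -mulr_sumr exprS mulN1r mulNr; congr (- (_ * _)).
  rewrite /rank_num -sum1dep_card -[Posz _]natz natr_sum /=; apply: eq_bigr => x _.
  rewrite (_ : [set y | _] = [set top]) ?cards1 //; apply/setP => y; rewrite !inE rk_top_eq.
  by case: eqVneq => [->|]; rewrite ?lex1 ?andbF.
Qed.

(** The sums above elements of rank m vanish, so [sum_above] can be solved for the unknown pairs. *)
Lemma rank_pairs_top m : (0 < m < n)%N -> rank_pairs m = top_pairs f n m.
Proof.
case/andP=> m0 mn; have := sum_above mn; rewrite big1 => [|x /eqP rx]; last first.
  by apply: euler_above; rewrite -?rk_eq0 rx // -lt0n.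
rewrite /top_pairs; set S := \sum_(l < n) _ => H.
have := signrMK n (rank_pairs m); have := signrMK n (f m).
move: H; move: ((-1) ^+ n) (rank_pairs m) (f m) => e c y H; nia.
Qed.

Lemma rank_pairs0 : rank_pairs 0 = f n.
Proof.
rewrite /rank_pairs (big_pred1 bot) => [|x]; last exact: rk_eq0.
by congr Posz; apply: eq_card => y; rewrite !inE le0x.
Qed.

Lemma sum_all : \sum_z (-1) ^+ rk z = 1 + \sum_(j < n) (-1) ^+ j.+1 * f j.+1 + (-1) ^+ n.+1 :> int.
Proof.
rewrite (@sum_rk xpredT) big_ord_recl big_ord_recr /= expr0 mul1r.
rewrite -[Posz _]/(f 0) rank_num0 addrA; congr (_ + _ + _).
rewrite /bump leq0n add1n.
rewrite (_ : [set z | _] = [set top]) ?cards1 ?mulr1 //.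
by apply/setP => z; rewrite !inE rk_top_eq.
Qed.

(** Above the bottom the alternating sum is that of the whole poset and may be nonzero. Solving
    [sum_above] leaves it with the sign (-1)^(n+1), which [euler_all] absorbs. *)
Lemma top_pairs0 : top_pairs f n 0 = f n + \sum_z (-1) ^+ rk z.
Proof.
have := sum_above n_gt0; rewrite (big_pred1 bot) => [|x]; last exact: rk_eq0.
rewrite (eq_bigl xpredT) => [|z]; last exact: le0x.
rewrite rank_pairs0 /top_pairs; set S := \sum_(l < n) _ => H.
have := euler_all; rewrite exprS.
have := signrMK n (f n); have := signrMK n (f 0).
move: H; move: ((-1) ^+ n) (\sum_z _) => e c H; nia.
Qed.

Lemma flag_f1 (j : 'I_n) : (flag_f le bot [set j])%:Z = f j.+1.
Proof.
congr Posz; rewrite -[RHS](card_imset _ (@set1_inj T)); apply: eq_card => C.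
rewrite inE; apply/and4P/imsetP => [[_ ]|[x]].
  rewrite cards1 => /cards1P[x ->] /forall_inP/(_ x (set11 x))/exists_inP[i /set1P -> rx] _.
  by exists x; rewrite // inE.
rewrite inE => rx ->; split.
- by apply/is_chainP => y z /set1P-> /set1P->; rewrite le_refl.
- by rewrite !cards1.
- by apply/forall_inP => y /set1P->; apply/exists_inP; exists j; rewrite ?set11.
- by apply/forall_inP => y /set1P->; apply/exists_inP; exists x; rewrite ?set11.
Qed.

Lemma flag_f'_mflags (S : {set 'I_n}) :
  flag_f' le bot S = mflags f n (rev (uS S)).
Proof.
rewrite /flag_f' (flag_f_nchains le_refl le_anti le_trans le0x S lex1 rk1) n_gt0 /=.
(* The sphere term 1 - (-1)^n accounts for the bottom and the top, and the Euler characteristic for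
   the ranks between. *)
have corr : euler_char_sphere n - euler_char le bot n = \sum_z (-1) ^+ rk z.
  rewrite sum_all /euler_char_sphere /euler_char exprS mulN1r.
  have -> : \sum_(j < n) (-1) ^+ j * (flag_f le bot [set j])%:Z
     = - \sum_(j < n) (-1) ^+ j.+1 * f j.+1.
    by rewrite -sumrN; apply: eq_bigr => j _; rewrite flag_f1 exprS; ring.
  by ring.
rewrite {}corr.
have szS : size (rev (uS S)) = n by rewrite size_rev size_uS.
have -> : (S == [set i : 'I_n | val i == n.-1]) = (rev (uS S) == true :: nseq n.-1 false).
  have <- : rev (uS [set i : 'I_n | val i == n.-1]) = true :: nseq n.-1 false.
    apply: (canLR revK); rewrite rev_cons rev_nseq.
    apply: (@eq_from_nth _ false); rewrite size_uS ?size_rcons ?size_nseq ?prednK // => i ni.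
    rewrite -[i]/(val (Ordinal ni)) nth_uS inE nth_rcons size_nseq /=.
    by rewrite nth_nseq; case: (ltngtP i n.-1) => // H; lia.
  rewrite (inj_eq (can_inj revK)); apply/eqP/eqP => [-> //|E].
  by apply/setP => i; rewrite -nth_uS E nth_uS.
case: (rev (uS S)) szS => [|l w] /= szw; first by move: n_gt0; rewrite -szw.
have wn : (size w < n)%N by rewrite -szw.
rewrite eqseq_cons; case: l; last by rewrite addr0 nchains_top.
rewrite /=; case: eqP => [->|wA].
  rewrite -[nseq _ _]cats0 sflags_nseq /= top_pairs0 size_cat size_nseq addn0 prednK //.
  congr (_ + _); rewrite (@sum_const_rank _ _ _ 1) ?mulr1 ?card_lt_top // => z _ _.
  by elim: (n.-1).
(* Under rank n the flag skips [p] ranks; its next element has rank [(size u).+1]. *)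
have [p [u wE]] : exists p u, w = nseq p false ++ true :: u.
  have: w != nseq (size w) false by apply/eqP => E; apply: wA; rewrite E -szw.
  elim: (w) => //= -[] v IH; first by exists 0%N, v.
  rewrite eqseq_cons eqxx => /IH[p [u ->]]; by exists p.+1, u.
have szE : (size w = p + (size u).+1)%N by rewrite wE size_cat size_nseq.
rewrite addr0 [in RHS]wE sflags_nseq /= -rank_pairs_top; last by move: szw; lia.
have nE y : nchains le bot y w = \sum_(x | lt x y && (rk x == (size u).+1)) nchains le bot x u.
  by rewrite wE; elim: (p).
under eq_bigr do rewrite nE.
transitivity (\sum_(y | lt y top && (rk y == (size w).+1))
   (#|[set x | lt x y && (rk x == (size u).+1)]|)%:Z * sflags (fun i => ('C((size u).+1, i))%:Z) u).
  apply: eq_bigr => y _; apply: sum_const_rank => x _ rx.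
  rewrite nchains_below rx //; lia.
rewrite -mulr_suml; congr (_ * _).
(* Pairs x < y with y of rank n, to be summed over x first: this turns them into [rank_pairs]. *)
transitivity (\sum_(y | rk y == n) \sum_(x | rk x == (size u).+1) (le x y)%:Z).
  rewrite szw; apply: congr_big => // [y|y /andP[_ /eqP ry]].
    rewrite ltE lex1 andbT; case: eqVneq => [->|//]; rewrite rk1; symmetry; apply/negbTE; lia.
  rewrite -sum1dep_card -[Posz _]natz natr_sum /=.
  rewrite [LHS]big_mkcond [RHS]big_mkcond; apply: eq_bigr => x _.
  rewrite ltE; case: (eqVneq x y) => [->|_] /=; last by case: (le x y); case: (rk x == _).
  rewrite ry; case: eqP => // E; lia.
rewrite exchange_big /rank_pairs; apply: eq_bigr => x _ /=.
rewrite -[in RHS]sum1dep_card -[Posz _]natz natr_sum /=.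
rewrite [LHS]big_mkcond [RHS]big_mkcond; apply: eq_bigr => y _.
by case: (le x y); case: (rk y == n).
Qed.

Lemma chi'_mflags (w : seq bool) :
  chi' le bot n w = if size w == n then mflags f n (rev w) else 0.
Proof.
rewrite /chi' /ncmon; case: eqP => [szw|szw]; last first.
  rewrite big1 // => S _; case: eqP => [E|]; rewrite ?mulr0 //.
  by case: szw; rewrite E size_uS.
pose S := [set i : 'I_n | nth false w i].
have wE : w = uS S.
  apply: (@eq_from_nth _ false); rewrite ?size_uS ?szw // => i ni.
  by rewrite -[i]/(val (Ordinal ni)) nth_uS inE.
rewrite (bigD1 S) //= -wE eqxx mulr1 flag_f'_mflags -wE big1 ?addr0 // => S' SS'.
case: eqP => [E|]; rewrite ?mulr0 //; case/eqP: SS'; apply/setP => i.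
by rewrite -nth_uS -E wE nth_uS.
Qed.

End SimplicialFlags.

(** * Semi-Eulerian simplicial posets *)

Section BooleanIntervals.

Variables (T : finType) (le : rel T) (bot : T).
Hypothesis le_refl : reflexive le.
Hypothesis le_anti : antisymmetric le.
Hypothesis le_trans : transitive le.
Hypothesis le0x : forall x, le bot x.
Local Notation rk := (rk le bot).

Lemma boolean_below_rank (x : T) (r : nat) : boolean_below le bot x r ->
  rk x = r /\ forall j, #|[set z | le z x && (rk z == j)]| = 'C(r, j).
Proof.
case/existsP => f /andP[/andP[/injectiveP f_inj /forallP f_codom] /forallP f_le].
have {}f_le A B : le (f A) (f B) = (A \subset B) by apply/eqP; apply: (forallP (f_le A)).
have below_codom z : le z x -> exists A, z = f A.
  move=> zx; have /eqP := f_codom z; rewrite inE le0x zx => /esym /codomP[A ->].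
  by exists A.
have le_f A : le (f A) x by have /eqP := f_codom (f A); rewrite inE le0x codom_f.
have xE : x = f setT.
  have [A xA] := below_codom x (le_refl x).
  by move: (le_f setT); rewrite xA f_le subTset => /eqP ->.
have rk_f A : rk (f A) = #|A|.
  (* Cardinality transported along [f]; the default 0 is taken only outside the interval below
     [x]. *)
  pose rho z := if [pick A | f A == z] is Some A then #|A| else 0%N.
  have rhoE B : rho (f B) = #|B|.
    by rewrite /rho; case: pickP => [C /eqP/f_inj -> //|/(_ B)]; rewrite eqxx.
  rewrite -rhoE; apply: (rk_unique le_refl le_anti le_trans le0x).
    move=> y z zA; rewrite ltE => /andP[yz lyz].
    have [B zB] := below_codom z (le_trans zA (le_f A)).
    have [C yC] := below_codom y (le_trans lyz (le_trans zA (le_f A))).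
    rewrite yC zB !rhoE proper_card // properEneq -f_le -yC -zB lyz andbT.
    by apply: contra yz => /eqP E; rewrite yC E zB.
  move=> z zA; have [B ->] := below_codom z (le_trans zA (le_f A)).
  rewrite rhoE => /card_gt0P[a aB]; exists (f (B :\ a)).
    rewrite ltE f_le subD1set andbT; apply/eqP => /f_inj E.
    by move: aB; rewrite -E in_setD1 eqxx.
  by rewrite !rhoE (cardsD1 a B) aB.
split; first by rewrite xE rk_f cardsT card_ord.
move=> j; rewrite -[in RHS](card_ord r) -card_draws -(card_imset _ f_inj).
apply: eq_card => z; rewrite inE; apply/andP/imsetP.
  case=> /below_codom[A ->]; rewrite rk_f => jA; exists A => //.
  by rewrite inE.
by case=> A; rewrite inE => jA ->; rewrite le_f rk_f.
Qed.

End BooleanIntervals.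

Section SemiEulerian.

Variables (T : finType) (le : rel T) (bot top : T) (n : nat).
Hypothesis n_gt0 : (0 < n)%N.
Hypothesis gP : graded_poset le bot top n.
Hypothesis eP : semi_eulerian le bot top.
Local Notation rk := (rk le bot).

Let le_refl : reflexive le. Proof. by case: gP => -[]. Qed.
Let le_anti : antisymmetric le. Proof. by case: gP => -[]. Qed.
Let le_trans : transitive le. Proof. by case: gP => -[]. Qed.
Let le0x x : le bot x. Proof. by case: gP => _ []. Qed.
Let lex1 x : le x top. Proof. by case: gP => _ []. Qed.

(** A chain of maximal size is a maximal chain, and gradedness fixes its size as n+2. *)
Lemma rk_top : rk top = n.+1.
Proof.
have [C /andP[cC sC] cardC] := rk_chain le_refl le0x top.
case: gP => _ [_ _ /(_ C)]; rewrite cardC => H; apply: succn_inj; apply: H.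
apply/andP; split => //; apply/forallP => D; apply/implyP => /proper_card CD.
apply/negP => cD; move: CD; rewrite cardC ltnNge => /negP; apply.
by apply: rk_max; rewrite cD; apply/subsetP => z _; rewrite inE le0x lex1.
Qed.

Lemma alt_interval s t : lt le s t -> ~ (s = bot /\ t = top) ->
  \sum_(z | le s z && le z t) (-1) ^+ rk z = 0 :> int.
Proof.
move=> st nbt; have := eP st nbt; rewrite -!sum1dep_card => H.
rewrite (bigID (fun z => odd (rk z))) /=.
have -> : \sum_(z | le s z && le z t && odd (rk z)) (-1) ^+ rk z
  = - (\sum_(z | (z \in Defs.interval le s t) && odd (rk z)) 1)%:Z :> int.
  rewrite -[Posz _]natz natr_sum -sumrN; apply: eq_big => [z|z /andP[_ oz]]; first by rewrite inE.
  by rewrite -signr_odd oz.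
have -> : \sum_(z | le s z && le z t && ~~ odd (rk z)) (-1) ^+ rk z
  = (\sum_(z | (z \in Defs.interval le s t) && ~~ odd (rk z)) 1)%:Z :> int.
  rewrite -[Posz _]natz natr_sum; apply: eq_big => [z|z /andP[_ oz]]; first by rewrite inE.
  by rewrite -signr_odd (negbTE oz).
by rewrite H addNr.
Qed.

Lemma alt_above x : x != bot -> x != top -> \sum_(z | le x z) (-1) ^+ rk z = 0 :> int.
Proof.
move=> x0 x1; rewrite -(@alt_interval x top) ?ltE ?x1 ?lex1 //; last by case=> /eqP; rewrite (negbTE x0).
by apply: eq_bigl => z; rewrite lex1 andbT.
Qed.

Lemma alt_below y : y != bot -> y != top -> \sum_(z | le z y) (-1) ^+ rk z = 0 :> int.
Proof.
move=> y0 y1; rewrite -(@alt_interval bot y) ?ltE 1?eq_sym ?y0 ?le0x //; last by case=> _ /eqP; rewrite (negbTE y1).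
by apply: eq_bigl => z; rewrite le0x.
Qed.

(* Sum (-1)^(rk x + rk y) over all pairs x <= y, first by x and then by y. *)
Lemma alt_all : \sum_z (-1) ^+ rk z = (-1) ^+ n.+1 * \sum_z (-1) ^+ rk z :> int.
Proof.
have bt : bot != top.
  apply/eqP => E; have := rk_top; rewrite -E.
  by have /eqP -> : rk bot == 0%N by rewrite (rk_eq0 le_refl le_anti le_trans le0x).
have rk0 : rk bot = 0%N by apply/eqP; rewrite (rk_eq0 le_refl le_anti le_trans le0x).
set e := \sum_z _.
have sum_top : \sum_(z | le top z) (-1) ^+ rk z = (-1) ^+ n.+1 :> int.
  rewrite (big_pred1 top) ?rk_top // => z.
  by apply/idP/eqP => [l|->]; [apply: le_anti; rewrite l lex1 | rewrite le_refl].
have sum_bot : \sum_(z | le z bot) (-1) ^+ rk z = 1 :> int.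
  rewrite (big_pred1 bot) ?rk0 // => z.
  by apply/idP/eqP => [l|->]; [apply: le_anti; rewrite l le0x | rewrite le_refl].
have sum_ge : \sum_x (-1) ^+ rk x * \sum_(y | le x y) (-1) ^+ rk y = e + 1.
  rewrite (bigD1 bot) //= rk0 expr0 mul1r (eq_bigl xpredT) => [|z]; last exact: le0x.
  congr (_ + _).
  rewrite (bigD1 top) 1?eq_sym //= sum_top rk_top sign_sq big1 ?addr0 // => x /andP[x0 x1].
  by rewrite alt_above ?mulr0.
have sum_le : \sum_y (-1) ^+ rk y * \sum_(x | le x y) (-1) ^+ rk x = 1 + (-1) ^+ n.+1 * e.
  rewrite (bigD1 bot) //= rk0 expr0 mul1r sum_bot; congr (_ + _).
  rewrite (bigD1 top) 1?eq_sym //= rk_top (eq_bigl xpredT) => [|z]; last exact: lex1.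
  by rewrite [X in _ + X]big1 ?addr0 // => y /andP[y0 y1]; rewrite alt_below ?mulr0.
have : e + 1 = 1 + (-1) ^+ n.+1 * e.
  rewrite -sum_ge -sum_le.
  under eq_bigr do rewrite mulr_sumr.
  under [RHS]eq_bigr do rewrite mulr_sumr.
  rewrite (exchange_big_dep xpredT) //=; apply: eq_bigr => y _; apply: eq_bigr => x _.
  exact: mulrC.
by rewrite addrC => /addrI.
Qed.

Hypothesis sP : simplicial le bot top.

Lemma boolean_belowE x r : (r <= n)%N -> boolean_below le bot x r = (rk x == r).
Proof.
move=> rn; apply/idP/eqP => [/(boolean_below_rank le_refl le_anti le_trans le0x)[]//|rx].
have [|r' xr'] := sP (x := x); first by apply/eqP => E; move: rx rn; rewrite E rk_top => <-; rewrite ltnn.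
by have [E _] := boolean_below_rank le_refl le_anti le_trans le0x xr'; rewrite -rx E.
Qed.

Lemma fvecE j : (j <= n)%N -> (fvec le bot j)%:Z = rank_num le bot j.
Proof.
by move=> jn; congr Posz; apply: eq_card => x; rewrite !inE boolean_belowE.
Qed.

Lemma chi'_simplicial w :
  chi' le bot n w = if size w == n then mflags (rank_num le bot) n (rev w) else 0.
Proof.
have ntop x : (rk x < n)%N -> x != top.
  by move=> xn; apply/eqP => E; move: xn; rewrite E rk_top => /ltnW; rewrite ltnn.
apply: (chi'_mflags le_refl le_anti le_trans le0x lex1 n_gt0 rk_top) => [y j yn|x x0 xn|].
- have [r yr] := sP (ntop y yn).
  by have [-> ->] := boolean_below_rank le_refl le_anti le_trans le0x yr.
- exact: alt_above (ntop x xn).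
- exact: alt_all.
Qed.

(* Only [f_0, ..., f_(n-1)] enter the flag numbers, so h_n drops out. *)
Lemma rank_num_hvec j : (j < n)%N ->
  rank_num le bot j = \sum_(i < n) hvec le bot n i * ('C(n - i, n - j))%:Z.
Proof.
move=> jn.
(* The f-polynomial in x; substituting x - 1 gives the h-polynomial [q], and substituting x + 1 back
   into [q] expresses f through h. *)
pose p : {poly int} := \sum_(j < n.+1) ((fvec le bot j)%:Z)%:P * 'X ^+ (n - j).
pose q : {poly int} := p \Po ('X - 1).
have hE i : hvec le bot n i = q`_(n - i).
  rewrite /hvec /q /p; congr (nth _ (polyseq _) _).
  rewrite raddf_sum; apply: eq_bigr => k _ /=.
  by rewrite comp_polyM comp_polyC comp_Xn_poly.
have pE : p = q \Po ('X + 1).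
  by rewrite /q -comp_polyA comp_polyB comp_polyX comp_polyC addrK comp_polyXr.
have szq : (size q <= n.+1)%N.
  rewrite /q; apply: (leq_trans (size_comp_poly_leq _ _)).
  rewrite size_XsubC /= muln1 ltnS.
  have : (size p <= n.+1)%N.
    apply: (leq_trans (size_sum _ _ _)); apply/bigmax_leqP => k _.
    rewrite mul_polyC; apply: (leq_trans (size_scale_leq _ _)); rewrite size_polyXn; lia.
  by rewrite -subn1 leq_subLR add1n.
have -> : rank_num le bot j = p`_(n - j).
  rewrite /p coef_sum (bigD1 (inord j)) //= big1 => [|k kj].
    by rewrite addr0 coefCM coefXn inordK ?eqxx ?mulr1 ?fvecE //; lia.
  rewrite coefCM coefXn; case: eqP => [E|]; rewrite ?mulr0 //.
  case/eqP: kj; apply/val_inj; rewrite /= inordK; have := ltn_ord k; lia.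
have qE : q = \sum_(i < n.+1) q`_i *: 'X^i.
  rewrite -poly_def; apply/polyP => i; rewrite coef_poly; case: ltnP => // ni.
  by rewrite nth_default // (leq_trans szq).
(* Reversing the index attaches h_i to the power n - i. The last term, h_n, is a constant and has no
   coefficient in degree n - j > 0. *)
rewrite pE qE raddf_sum /= coef_sum (reindex_inj rev_ord_inj) big_ord_recr /=.
rewrite subnn [X in _ + X](_ : _ = 0) ?addr0; last first.
  rewrite comp_polyZ comp_Xn_poly coefZ expr0 coef1.
  by rewrite (_ : (n - j == 0)%N = false) ?mulr0 //; lia.
apply: eq_bigr => i _; rewrite subSS hE comp_polyZ comp_Xn_poly coefZ; congr (_ * _).
rewrite addrC exprDn coef_sum; set m := (n - j)%N; set k := (n - i)%N.
have cE (l : 'I_k.+1) : (1 ^+ (k - l) * 'X^l *+ 'C(k, l) : {poly int})`_m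
  = (m == l)%:R * ('C(k, l))%:Z.
  by rewrite coefMn expr1n mul1r coefXn -[LHS]mulr_natr; congr (_ * _); exact: natz.
under eq_bigr do rewrite cE.
case: (ltnP k m) => [km|mk].
  rewrite bin_small // big1 // => l _; case: eqP => [ml|]; rewrite ?mul0r //.
  by have := ltn_ord l; rewrite -ml ltnNge km.
rewrite (bigD1 (inord m)) //= big1 => [|l lm].
  by rewrite inordK ?ltnS // eqxx addr0 mul1r.
case: eqP => [ml|]; rewrite ?mul0r //; case/eqP: lm; apply/val_inj.
by rewrite /= inordK ?ltnS // ml.
Qed.


End SemiEulerian.

(** * The semisuspensions *)

(** If some a lies outside F, adding or removing a is a sign-reversing involution on the supersets
    of F. *)
Lemma alt_supersets (T : finType) (F : {set T}) :
  \sum_(G : {set T} | F \subset G) (-1) ^+ #|G| = (F == setT)%:R * (-1) ^+ #|T| :> int.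
Proof.
case: eqVneq => [->|]; first rewrite mul1r (big_pred1 setT) ?cardsT // => G.
  by rewrite subTset.
rewrite -subTset => /subsetPn[a _ aF]; rewrite mul0r.
rewrite (bigID (fun G : {set T} => a \in G)) /=.
rewrite (reindex_onto (fun G => a |: G) (fun G => G :\ a)) /=; last first.
  by move=> G /andP[_ aG]; rewrite setD1K.
set S := \sum_(G : {set T} | _ && (a \notin G)) _.
rewrite (_ : \sum_(G | _) _ = - S) ?addNr // /S -sumrN; apply: eq_big => G.
  rewrite setU11 andbT; case: (boolP (a \in G)) => aG; rewrite /= ?andbT ?andbF.
    rewrite andbC; apply/negbTE/negP => /andP[/eqP E _].
    by move: aG; rewrite -E in_setD1 eqxx.
  rewrite setU1K // eqxx andbT; apply/subsetP/subsetP => FG x xF.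
    by have /setU1P[E|//] := FG x xF; move: aF; rewrite -E xF.
  by rewrite setU1r ?FG.
case/andP=> _ /eqP E; have aG : a \notin G by rewrite -E in_setD1 eqxx.
by rewrite cardsU1 aG exprS mulN1r.
Qed.

(** The complement of [a |: G] is an arbitrary (n-j)-subset of the complement of [a |: K], which has
    n - |K| elements. *)
Lemma card_between (n : nat) (K : {set 'I_n.+1}) (a : 'I_n.+1) (j : nat) :
  a \notin K -> (j <= n)%N ->
  #|[set G : {set 'I_n.+1} | [&& K \subset G, a \notin G & #|G| == j]]| = 'C(n - #|K|, n - j).
Proof.
move=> aK jn.
have cardaK : #|~: (a |: K)| = (n - #|K|)%N.
  have := cardsC (a |: K); rewrite cardsU1 aK card_ord.
  by move: #|K| #|~: _| => k l; lia.
have aH (H : {set 'I_n.+1}) : H \subset ~: (a |: K) -> a \notin H.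
  by move=> HK; apply/negP => /(subsetP HK); rewrite inE setU11.
rewrite -cardaK -cards_draws -(card_in_imset (f := fun H => ~: (a |: H))); last first.
  move=> H H'; rewrite !inE => /andP[/aH aHH _] /andP[/aH aHH' _] /setC_inj E.
  by rewrite -(setU1K aHH) E setU1K.
apply: eq_card => G; rewrite inE; apply/and3P/imsetP => [[KG aG /eqP cG]|[H]].
  exists (~: G :\ a); last by rewrite setD1K ?setCK // inE.
  rewrite inE; apply/andP; split.
    apply/subsetP => x; rewrite !inE => /andP[xa xG]; rewrite negb_or xa /=.
    by apply: contra xG; apply: (subsetP KG).
  have := cardsD1 a (~: G); have := cardsC G; rewrite inE aG card_ord cG => h1 h2.
  by apply/eqP; move: h1 h2; move: #|~: G| #|_ :\ _| => k l; lia.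
rewrite inE => /andP[HK /eqP cH] ->; split.
- by rewrite setCU subsetI; apply/andP; split; apply/subsetP => x xK;
    rewrite !inE; [apply: contra aK => /eqP <- | apply/negP => /(subsetP HK); rewrite !inE xK orbT].
- by rewrite !inE eqxx.
- have := cardsC (a |: H); rewrite cardsU1 (aH _ HK) cH card_ord => h.
  by apply/eqP; move: h; move: #|~: _| => k; lia.
Qed.

Section LambdaFlags.

Variables (n i : nat).
Hypothesis i_lt_n : (i < n)%N.
Let J : {set 'I_n.+1} := [set j : 'I_n.+1 | (val j <= i)%N].
Local Notation le := (@lam_le n i).
Local Notation bot := (lam_bot n i).
Local Notation top := (lam_top n i).

Lemma inGammaE (F : {set 'I_n.+1}) : inGamma i F = ~~ ([set j : 'I_n.+1 | (val j <= i)%N] \subset F).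
Proof.
apply/existsP/subsetPn => [[j /andP[ji jF]]|[j]].
  by exists j; rewrite ?inE.
by rewrite inE => ji jF; exists j; rewrite ji.
Qed.

(** A ridge is the complement of two vertices a, b and lies in the facets sigma_a and sigma_b only.
    It is a boundary ridge exactly when one of a, b is in [J], so boundary faces are those missing a
    vertex of [J] and a vertex outside [J]. *)
Lemma inBoundaryE (F : {set 'I_n.+1}) :
  inBoundary i F = inGamma i F && (F :|: J != setT).
Proof.
rewrite inGammaE -/J; apply/existsP/andP.
  case=> G /and3P[FG /eqP cG /cards1P[a Ga]].
  have aG : a \in J :\: G by have := set11 a; rewrite -Ga !inE => /andP[-> ->].
  split.
    apply/subsetPn; exists a; move: aG; rewrite in_setD => /andP[aG aJ] //.
    by apply: contra aG; exact: (subsetP FG).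
  apply/eqP => E.
  have : G :|: J = setT by apply/eqP; rewrite -subTset -E setSU.
  move=> /(congr1 (fun A : {set _} => #|A|)); rewrite cardsT card_ord.
  have -> : G :|: J = a |: G.
    apply/setP => x; rewrite !inE; have := congr1 (fun A : {set _} => x \in A) Ga.
    by rewrite !inE => <-; case: (x \in G); rewrite ?orbT ?orbF ?andbT.
  rewrite cardsU1 cG; have := leq_b1 (a \notin G); move: i_lt_n; lia.
case=> /subsetPn[a aJ aF]; rewrite -subTset => /subsetPn[b _].
rewrite in_setU negb_or => /andP[bF bJ].
exists (~: [set a; b]); apply/and3P; split.
- apply/subsetP => x xF; rewrite !inE negb_or; apply/andP.
  by split; apply/eqP => E; [move: aF | move: bF]; rewrite -E xF.
- have ab : a != b by apply: contra bJ => /eqP <-.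
  have := cardsC [set a; b]; rewrite cards2 ab card_ord; move: i_lt_n => h1 h2.
  by apply/eqP; move: h2; move: #|~: _| => k; lia.
apply/cards1P; exists a; apply/setP => x; rewrite !inE negbK.
move: aJ bJ; rewrite !inE => aJ bJ.
case: (eqVneq x a) => [->|xa]; first by rewrite aJ.
by case: (eqVneq x b) => [->|xb]; rewrite ?andbF // (negbTE bJ).
Qed.

Lemma inGamma_sub (F G : {set 'I_n.+1}) : F \subset G -> inGamma i G -> inGamma i F.
Proof. by move=> FG; rewrite !inGammaE; apply: contra => /subset_trans ->. Qed.

Lemma inBoundary_sub (F G : {set 'I_n.+1}) : F \subset G -> inBoundary i G -> inBoundary i F.
Proof.
move=> FG /existsP[H /and3P[GH cH fH]]; apply/existsP; exists H.
by rewrite (subset_trans FG GH) cH.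
Qed.

Lemma inBoundary0 : inBoundary i (set0 : {set 'I_n.+1}).
Proof.
rewrite inBoundaryE set0U inGammaE -/J; apply/andP; split.
  by apply/subsetPn; exists ord0; rewrite inE.
by rewrite -subTset; apply/subsetPn; exists ord_max; rewrite ?inE //= -ltnNge.
Qed.

Lemma lam_refl : reflexive le.
Proof. by case=> [[F|[]] hF]; rewrite /lam_le /=. Qed.

Lemma lam_anti : antisymmetric le.
Proof.
move=> [[F|[]] hF] [[G|[]] hG]; rewrite /lam_le //= ?andbF // => H; apply/val_inj => //=.
by congr inl; apply/eqP; rewrite eqEsubset.
Qed.

Lemma lam_trans : transitive le.
Proof.
move=> [[G|[]] hG] [[F|[]] hF] [[H|[]] hH]; rewrite /lam_le //=.
- exact: subset_trans.
- exact: inBoundary_sub.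
Qed.

Lemma lam0x x : le bot x.
Proof. by case: x => [[F|[]] hF]; rewrite /lam_le //= ?sub0set ?inBoundary0. Qed.

Lemma lamx1 x : le x top.
Proof. by case: x => [[F|[]] hF]. Qed.

Definition lam_rank (x : {set 'I_n.+1} + bool) : nat :=
  match x with inl F => #|F| | inr b => n + b end.

Lemma inGamma_card (F : {set 'I_n.+1}) : inGamma i F -> (#|F| <= n)%N.
Proof.
rewrite inGammaE => FJ; rewrite -ltnS -[X in (_ < X)%N]card_ord -cardsT proper_card //.
by rewrite properT; apply: contra FJ => /eqP ->; rewrite subsetT.
Qed.

Lemma rk_lam (x : Lam n i) : rk le bot x = lam_rank (val x).
Proof.
apply: (rk_unique lam_refl lam_anti lam_trans lam0x (rho := fun x => lam_rank (val x))).
  move=> [[F|[]] hF] [[G|[]] hG] _; rewrite ltE -val_eqE /lam_le //= ?addn0 ?addn1 //.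
  - by case/andP=> FG sFG; rewrite proper_card // properEneq sFG andbT.
  - by rewrite ltnS inGamma_card.
  - case/existsP=> G /and3P[/subset_leq_card FG /eqP cG _].
    rewrite cG in FG; apply: (leq_ltn_trans FG); rewrite prednK //; exact: leq_ltn_trans i_lt_n.
move=> [[F|[]] hF] _ /=; rewrite ?addn0 ?addn1.
- case/card_gt0P=> a aF; have hG : lam_elt i (inl (F :\ a)) by apply: inGamma_sub hF; exact: subD1set.
  exists (exist (fun x => lam_elt i x) (inl (F :\ a)) hG); last by rewrite /= (cardsD1 a F) aF.
  rewrite ltE -val_eqE /lam_le /= subD1set andbT; apply/eqP => -[E].
  by move: aF; rewrite -E in_setD1 eqxx.
- by move=> _; exists (exist (fun x => lam_elt i x) (inr false) isT); rewrite //= addn0.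
(* Directly under tau lies any boundary ridge; the empty face being in the boundary provides one. *)
- move=> _; have /existsP[G /and3P[_ /eqP cG nG]] := inBoundary0.
  have bG : inBoundary i G by apply/existsP; exists G; rewrite subxx cG eqxx nG.
  have hG : lam_elt i (inl G) by move: bG; rewrite inBoundaryE => /andP[].
  exists (exist (fun x => lam_elt i x) (inl G) hG); first by rewrite ltE -val_eqE /lam_le /= bG.
  by rewrite /= cG prednK //; move: i_lt_n; lia.
Qed.

Lemma sum_lam (P : pred ({set 'I_n.+1} + bool)) (F : {set 'I_n.+1} + bool -> int) :
  \sum_(x : Lam n i | P (val x)) F (val x)
  = \sum_(G | inGamma i G && P (inl G)) F (inl G) + \sum_(b | P (inr b)) F (inr b).
Proof.
have := big_sumType _ (fun x => lam_elt i x && P x) F => /= <-.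
exact/esym/(@big_sub_cond _ _ _ _ (fun x => lam_elt i x) P F).
Qed.

Lemma card_lam (P : pred ({set 'I_n.+1} + bool)) : (forall b, P (inr b) = false) ->
  (#|[set x : Lam n i | P (val x)]|)%:Z = (#|[set G | inGamma i G && P (inl G)]|)%:Z.
Proof.
move=> Pb; rewrite -!sum1dep_card -![Posz _]natz !natr_sum (sum_lam P (fun=> 1)).
by rewrite [X in _ + X]big_pred0 ?addr0.
Qed.

(** All supersets of a face F sum to 0, so the faces of Gamma above F sum to minus the non-faces,
    the sets containing F and [J]. This is 0 unless F and [J] cover all vertices, when it is (-1)^n;
    in just that case tau is not above F. Either way (-1)^n is contributed once and cancels the
    top. *)
Lemma alt_above_lam (x : Lam n i) : (rk le bot x < n)%N ->
  \sum_(z | le x z) (-1) ^+ rk le bot z = 0 :> int.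
Proof.
under eq_bigr do rewrite rk_lam.
rewrite rk_lam /lam_le (sum_lam (lam_le_raw i (val x)) (fun y => (-1) ^+ lam_rank y)).
case: x => [[F|b] hF] /=; last by rewrite ltnNge leq_addr.
move=> Fn; rewrite [X in _ + X]big_mkcond big_bool /= addn0 addn1 inBoundaryE.
have -> : inGamma i F = true by exact: hF.
have FT : F != setT by apply/eqP => E; move: Fn; rewrite E cardsT card_ord => /ltnW; rewrite ltnn.
have := alt_supersets F; rewrite (negbTE FT) mul0r (bigID (inGamma i)) /=.
rewrite (eq_bigl (fun G => inGamma i G && (F \subset G))) => [|G]; last exact: andbC.
move=> /eqP; rewrite addr_eq0 => /eqP ->.
rewrite (eq_bigl (fun G : {set 'I_n.+1} => F :|: J \subset G)) => [|G]; last first.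
  by rewrite inGammaE negbK subUset.
rewrite alt_supersets card_ord exprS; case: eqP => _ /=; ring.
Qed.

Lemma chi'_lam w : chi' le bot n w =
  if size w == n then mflags (rank_num le bot) n (rev w) else 0.
Proof.
have n0 : (0 < n)%N by apply: leq_ltn_trans i_lt_n.
apply: (chi'_mflags lam_refl lam_anti lam_trans lam0x lamx1 n0).
- by rewrite rk_lam /= addn1.
- move=> y j; rewrite rk_lam => yn; apply/eqP; rewrite -eqz_nat; apply/eqP.
  rewrite (_ : [set z | _] = [set z : Lam n i | lam_le_raw i (val z) (val y) && (lam_rank (val z) == j)]).
    case: y yn => [[F|b] hF] /=; last by rewrite ltnNge leq_addr.
    move=> Fn; rewrite (card_lam (P := fun z : {set 'I_n.+1} + bool => lam_le_raw i z (inl F) && (lam_rank z == j))) //; last by case.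
    rewrite -cards_draws; congr Posz; apply: eq_card => G; rewrite !inE /=.
    case: (boolP (G \subset F)) => [GF|_]; last by rewrite andbF.
    by rewrite (inGamma_sub GF hF).
  by apply/setP => z; rewrite !inE rk_lam.
- move=> x _; exact: alt_above_lam.
- have := @alt_above_lam bot; rewrite rk_lam /= cards0 => /(_ n0).
  by rewrite (eq_bigl xpredT) => [->|z]; rewrite ?mulr0 ?lam0x.
Qed.

Lemma rank_num_lam j : (j < n)%N ->
  rank_num le bot j = (#|[set G : {set 'I_n.+1} | inGamma i G & #|G| == j]|)%:Z.
Proof.
move=> jn; rewrite -(card_lam (P := fun z : {set 'I_n.+1} + bool => lam_rank z == j)) => [|b]; last first.
  by apply/negbTE; rewrite neq_ltn orbC /= (leq_trans jn) ?leq_addr.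
by congr Posz; apply: eq_card => x; rewrite !inE rk_lam.
Qed.

End LambdaFlags.

(** Gamma_0 is the simplex sigma_0 on the n vertices other than 0. C(n, j) is written as C(n, n-j)
    to fit the pattern of the later increments. *)
Lemma rank_num_lam0 (n j : nat) : (j < n)%N ->
  rank_num (@lam_le n 0) (lam_bot n 0) j = ('C(n, n - j))%:Z.
Proof.
move=> jn; rewrite rank_num_lam //; last by lia.
have := @card_between n set0 ord0 j; rewrite in_set0 cards0 subn0 => <- //; last exact: ltnW.
congr Posz; apply: eq_card => G; rewrite [LHS]inE [RHS]inE inGammaE sub0set -sub1set.
have -> : [set x : 'I_n.+1 | (val x <= 0)%N] = [set ord0] by apply/setP => x; rewrite !inE leqn0.
by [].
Qed.

(** A shelling step: the faces that sigma_(i+1) adds miss the vertex i+1 and contain 0, ..., i. The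
    smallest of them has i+1 vertices, which is why they match h_(i+1). *)
Lemma rank_num_lamS (n i j : nat) : (i.+1 < n)%N -> (j < n)%N ->
  rank_num (@lam_le n i.+1) (lam_bot n i.+1) j
  = rank_num (@lam_le n i) (lam_bot n i) j + ('C(n - i.+1, n - j))%:Z.
Proof.
move=> i_n jn; rewrite !rank_num_lam //; last by apply: ltnW.
set K := [set x : 'I_n.+1 | (val x <= i)%N].
have i_n1 : (i.+1 < n.+1)%N by apply: ltnW.
pose a := Ordinal i_n1.
have cK : #|K| = i.+1.
  rewrite -sum1dep_card -[RHS]card_ord -[RHS]sum1_card; symmetry.
  rewrite (big_ord_widen n.+1 (fun=> 1%N) (ltnW i_n1)).
  by apply: eq_bigl => x; rewrite ltnS.
have aK : a \notin K by rewrite inE /= ltnn.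
have := card_between aK (ltnW jn); rewrite cK => <-.
rewrite -PoszD -[in LHS](cardsID [set G | inGamma i G & #|G| == j]); congr Posz.
have GS (G : {set 'I_n.+1}) : inGamma i.+1 G = inGamma i G || (a \notin G).
  rewrite !inGammaE -negb_and andbC -sub1set -subUset.
  rewrite (_ : [set x : 'I_n.+1 | (val x <= i.+1)%N] = [set a] :|: K) //.
  by apply/setP => x; rewrite !inE leq_eqVlt -val_eqE.
congr (_ + _)%N; apply: eq_card => G; rewrite !inE GS.
  by case: (inGamma i G); case: (#|G| == j); rewrite ?andbF.
by rewrite inGammaE; case: (K \subset G); case: (a \in G); case: (#|G| == j).
Qed.

Theorem theorem3p6 (T : finType) (le : rel T) (bot top : T) (n : nat) :
  (1 <= n)%N ->
  graded_poset le bot top n ->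
  semi_eulerian le bot top ->
  simplicial le bot top ->
  forall w : seq bool,
    cd_index le bot n w = \sum_(i < n) hvec le bot n i * check_Phi n i w.
Proof.
move=> n_gt0 gP eP sP; apply: ncsubst_cd_inj => w; rewrite ncsubst_sum.
pose fL i := rank_num (@lam_le n i) (lam_bot n i).
have chiP := chi'_simplicial n_gt0 gP eP sP.
(* A chi' of the form [mflags] satisfies the relations by [gds_mflags], so the epsilon choice can be
   evaluated for [P] and the semisuspensions alike. *)
have mflags_index (U : finType) (leU : rel U) b f :
    (forall v, chi' leU b n v = if size v == n then mflags f n (rev v) else 0) ->
  ncsubst sub_cd (cd_index leU b n) w
  = ncsubst sub_ab (fun v => if size v == n then mflags f n (rev v) else 0) w.
  move=> chiE; rewrite cd_index_spec; first exact: eq_ncsubst.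
  move=> u k v hu hv; rewrite chiE -(@gds_mflags f n u k v hu hv).
  by apply: eq_bigr => j _; rewrite chiE.
have PhiE i : (i < n)%N -> ncsubst sub_cd (Phi_Lam n i) w
  = ncsubst sub_ab (fun v => if size v == n then mflags (fL i) n (rev v) else 0) w.
  by move=> i_n; apply: mflags_index; exact: chi'_lam.
(* The increment of the f-vector due to sigma_i, which is also the row of coefficients of h_i in
   [rank_num_hvec]; linearity of [mflags] then matches both sides. *)
pose g i j : int := ('C(n - i, n - j))%:Z.
have checkE i : (i < n)%N -> ncsubst sub_cd (check_Phi n i) w
  = ncsubst sub_ab (fun v => if size v == n then mflags (g i) n (rev v) else 0) w.
  case: i => [|i] i_n; rewrite /check_Phi leqNgt i_n /=.
    rewrite PhiE //; apply: eq_ncsubst => v; case: eqP => // sv.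
    by apply: eq_mflags; rewrite ?size_rev // => j jn; rewrite /fL rank_num_lam0 // /g subn0.
  rewrite ncsubstB !PhiE //; last exact: ltnW.
  apply/eqP; rewrite subr_eq -ncsubstD; apply/eqP/eq_ncsubst => v.
  case: eqP => sv; last by rewrite addr0.
  (* A sum over [bool] with unit weights, so that [mflags_sum] serves as additivity. *)
  pose h (b : bool) := if b then g i.+1 else fL i.
  transitivity (mflags (fun j => \sum_b 1 * h b j) n (rev v)).
    apply: eq_mflags; rewrite ?size_rev // => j jn.
    by rewrite big_bool /= !mul1r addrC /fL rank_num_lamS.
  by rewrite mflags_sum big_bool /= !mul1r.
under eq_bigr => i _ do rewrite checkE ?ltn_ord //.
rewrite -ncsubst_sum (mflags_index _ _ _ _ chiP); apply: eq_ncsubst => v.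
case: eqP => sv; last by rewrite big1 // => i _; rewrite mulr0.
rewrite -mflags_sum; apply: eq_mflags; rewrite ?size_rev // => j jn.
exact: (rank_num_hvec n_gt0 gP sP jn).
Qed.
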